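(* Let $I$ be a dense linear order with a left endpoint $0$ and no right endpoint, and let $\mathcal{L}(I)$ be the structure described in the context. Then $\mathcal{L}(I)$ is model-complete: every first-order formula in its signature is equivalent in $\mathcal{L}(I)$ to an existential formula.
   Context: Let $\mathcal{P}_{\mathrm{fci}}(I)$ be the set of finite unions of closed intervals of $I$. Here a closed interval is a set of the form $[i,j]=\{k: i\le k\le j\}$, $[i,+\infty)=\{k: i\le k\}$ or $(-\infty,j]=\{k:k\le j\}$ with $i,j\in I$. Let $\mathcal{L}(I)$ be the structure with universe $\mathcal{P}_{\mathrm{fci}}(I)$ in the signature $\{\cup,\cap,\bot,c_0,\min,\max,l,r\}$, interpreted as follows. - $\cup$ and $\cap$ are union and intersection. - $\bot$ is $\emptyset$, and $c_0$ is $\{0\}$. - $\min(A)$ is the singleton of the least element of $A$, with $\min(\emptyset)=\emptyset$. - $\max(A)$ is the singleton of the greatest element of $A$ when $A$ is nonempty and bounded, and $\emptyset$ when $A$ is empty or unbounded. - $l(A)$ is the set of left endpoints of $A$, and $r(A)$ is the set of right endpoints of $A$. Endpoints are defined via the maximal closed intervals whose finite union is $A$. The left endpoints are the minima of these intervals. The right endpoints are the maxima of the bounded ones. *)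

(* Defs.v *)
From Stdlib Require Import List.
Import ListNotations.

Section LI.
Variables (I : Type) (le : I -> I -> Prop) (z : I).

Definition lt (x y : I) : Prop := le x y /\ x <> y.

Inductive cint : Type :=
| Icc (i j : I)
| Ici (i : I)
| Iic (j : I).

Definition cint_set (c : cint) : I -> Prop :=
  match c with
  | Icc i j => fun k => le i k /\ le k j
  | Ici i => fun k => le i k
  | Iic j => fun k => le k j
  end.

Definition is_closed_interval (S : I -> Prop) : Prop :=
  exists c, forall x, S x <-> cint_set c x.

Definition fci (A : I -> Prop) : Prop :=
  exists s : list cint, forall x, A x <-> exists c, In c s /\ cint_set c x.

Definition subset (A B : I -> Prop) : Prop := forall x, A x -> B x.

Definition max_interval_of (A J : I -> Prop) : Prop :=
  is_closed_interval J /\ (exists x, J x) /\ subset J A /\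
  (forall J', is_closed_interval J' -> subset J J' -> subset J' A -> subset J' J).

Definition s_union (A B : I -> Prop) : I -> Prop := fun x => A x \/ B x.
Definition s_inter (A B : I -> Prop) : I -> Prop := fun x => A x /\ B x.
Definition s_bot : I -> Prop := fun _ => False.
Definition s_c0 : I -> Prop := fun x => x = z.
Definition s_min (A : I -> Prop) : I -> Prop :=
  fun x => A x /\ forall y, A y -> le x y.
(* singleton of the greatest element of A, empty if there is none
   (i.e. A empty or unbounded) *)
Definition s_max (A : I -> Prop) : I -> Prop :=
  fun x => A x /\ forall y, A y -> le y x.
Definition s_l (A : I -> Prop) : I -> Prop :=
  fun x => exists J, max_interval_of A J /\ J x /\ forall y, J y -> le x y.
Definition s_r (A : I -> Prop) : I -> Prop :=
  fun x => exists J, max_interval_of A J /\ J x /\ forall y, J y -> le y x.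

End LI.

Inductive term : Type :=
| TVar (n : nat)
| TUnion (t1 t2 : term)
| TInter (t1 t2 : term)
| TBot
| TC0
| TMin (t : term)
| TMax (t : term)
| TL (t : term)
| TR (t : term).

Inductive formula : Type :=
| FEq (t1 t2 : term)
| FFalse
| FNot (f : formula)
| FAnd (f1 f2 : formula)
| FOr (f1 f2 : formula)
| FImp (f1 f2 : formula)
| FEx (n : nat) (f : formula)
| FAll (n : nat) (f : formula).

Fixpoint qf (f : formula) : Prop :=
  match f with
  | FEq _ _ | FFalse => True
  | FNot g => qf g
  | FAnd g h | FOr g h | FImp g h => qf g /\ qf h
  | FEx _ _ | FAll _ _ => False
  end.

Inductive existential : formula -> Prop :=
| ex_qf f : qf f -> existential f
| ex_ex n f : existential f -> existential (FEx n f).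

Section Sem.
Variables (I : Type) (le : I -> I -> Prop) (z : I).

Definition assignment := nat -> (I -> Prop).

Definition update (rho : assignment) (n : nat) (A : I -> Prop) : assignment :=
  fun m => if Nat.eqb m n then A else rho m.

Fixpoint eval (rho : assignment) (t : term) : I -> Prop :=
  match t with
  | TVar n => rho n
  | TUnion a b => s_union I (eval rho a) (eval rho b)
  | TInter a b => s_inter I (eval rho a) (eval rho b)
  | TBot => s_bot I
  | TC0 => s_c0 I z
  | TMin a => s_min I le (eval rho a)
  | TMax a => s_max I le (eval rho a)
  | TL a => s_l I le (eval rho a)
  | TR a => s_r I le (eval rho a)
  end.

Fixpoint sat (rho : assignment) (f : formula) : Prop :=
  match f with
  | FEq a b => forall x, eval rho a x <-> eval rho b x
  | FFalse => False
  | FNot g => ~ sat rho g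
  | FAnd g h => sat rho g /\ sat rho h
  | FOr g h => sat rho g \/ sat rho h
  | FImp g h => sat rho g -> sat rho h
  | FEx n g => exists A, fci I le A /\ sat (update rho n A) g
  | FAll n g => forall A, fci I le A -> sat (update rho n A) g
  end.

Definition equiv_in_LI (f g : formula) : Prop :=
  forall rho : assignment, (forall n, fci I le (rho n)) -> (sat rho f <-> sat rho g).

Definition model_complete_LI : Prop :=
  forall f : formula, exists g : formula, existential g /\ equiv_in_LI f g.

End Sem.

Definition dlo_left_endpoint_no_right (I : Type) (le : I -> I -> Prop) (z : I) : Prop :=
  (forall x, le x x) /\
  (forall x y, le x y -> le y x -> x = y) /\
  (forall x y w, le x y -> le y w -> le x w) /\
  (forall x y, le x y \/ le y x) /\
  (forall x y, lt I le x y -> exists w, lt I le x w /\ lt I le w y) /\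
  (forall x, le z x) /\
  (forall x, exists y, lt I le x y).

(* Main.v *)
(* A tuple of finite unions of intervals is a word: cut I at finitely many points
   so that every set is constant on each open gap, and read off, at each cut
   point, which sets contain the point and which contain the gap to its right.
   A first-order formula defines a set of words which is recognized by a finite
   automaton that is insensitive to superfluous cuts; complementing a
   deterministic automaton handles negation, and a subset construction that lets
   every gap be cut further handles the quantifiers. Conversely, acceptance by an
   automaton is existential: an accepting run is coded by closed sets X_mu, the
   union of the closed gaps on which the run makes the transition mu. With the
   parity of the position included in mu, these gaps are the components of X_mu,
   so l(X_mu) and r(X_mu) are their endpoints, and being an accepting run is a
   quantifier-free condition on the X_mu. *)

From mathcomp Require Import all_boot boolp zify.
Require Import Defs.

Set Implicit Arguments.
Unset Strict Implicit.
Unset Printing Implicit Defensive.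

(** Automata read arbitrary piecewise constant sets, not only members of the universe: projection
    produces a step function as witness, and membership in the universe is itself recognizable, as
    it says that a set contains the ends of every gap it fills. Elements enter as singletons, so
    that [min], [max], [l] and [r] can be treated pointwise.

    The obstacle to coding a run is that the X_mu are closed: neighbouring gaps share a cut, so an
    X_mu cannot isolate an open gap. The coded sets are closed too, and this removes the ambiguity:
    a set that fills a gap contains its ends, and a set that misses the gap meets the closed gap at
    most in its ends. The value at a cut is tested only where a component starts. The last gap has
    no right end, so acceptance is expressed through [max]: a label whose target is not final must
    have a bounded X_mu.

    The X_mu need neither be disjoint nor cover I. Since the automaton is deterministic, following
    one chain of components from 0 already determines its state at every cut. *)

Section Model.

Variables (I : Type) (le : I -> I -> Prop) (z : I).
Hypothesis HI : dlo_left_endpoint_no_right I le z.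

Implicit Types (A B : I -> Prop) (x y t u w : I).

(** * Order axioms and automation for the dense order *)

Let le_refl x : le x x.
Proof. by case: HI. Qed.

Let le_anti x y : le x y -> le y x -> x = y.
Proof. by case: HI => _ [+ _]; apply. Qed.

Let le_trans x y w : le x y -> le y w -> le x w.
Proof. by case: HI => _ [_ [+ _]]; apply. Qed.

Let le_total x y : le x y \/ le y x.
Proof. by case: HI => _ [_ [_ [+ _]]]; apply. Qed.

Let ge_z x : le z x.
Proof. by case: HI => _ [_ [_ [_ [_ [+ _]]]]]; apply. Qed.

Local Notation "x ≺ y" := (~ le y x) (at level 70).

Let nle_le x y : x ≺ y -> le x y.
Proof. by case: (le_total x y). Qed.

Let nle_lt x y : lt I le x y <-> x ≺ y.
Proof.
split=> [[xy ne] yx|xy]; first by apply: ne; apply: le_anti.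
by split=> [|eqxy]; [exact: nle_le|apply: xy; rewrite eqxy].
Qed.

Let le_nn x y : ~ (x ≺ y) -> le y x.
Proof. by move/contrapT. Qed.

Let dense x y : x ≺ y -> exists2 w, x ≺ w & w ≺ y.
Proof.
case: HI => _ [_ [_ [_ [+ _]]]] => H /nle_lt/H [w [/nle_lt ? /nle_lt ?]].
by exists w.
Qed.

Let no_max x : exists y, x ≺ y.
Proof.
case: HI => _ [_ [_ [_ [_ [_ /(_ x)[y /nle_lt ?]]]]]].
by exists y.
Qed.

(* Saturates the weak inequalities under transitivity; a strict one is a
   negated [le]. *)
Ltac ord_sat :=
  repeat match goal with
  | H : _ /\ _ |- _ => destruct H
  | H : @eq I _ _ |- _ => subst
  end;
  repeat match goal with
  | H : ~ le ?x ?y |- _ =>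
      lazymatch goal with
      | _ : le y x |- _ => fail
      | _ => pose proof (nle_le H)
      end
  end;
  repeat match goal with
  | H : le ?x ?y, H' : le ?y ?w |- _ =>
      lazymatch goal with
      | _ : le x w |- _ => fail
      | _ => pose proof (le_trans H H')
      end
  end;
  solve [match goal with
  | H : ~ le ?x ?x |- _ => exact (False_ind _ (H (le_refl x)))
  | H : ~ le ?x ?y, H' : le ?x ?y |- _ => exact (False_ind _ (H H'))
  end].

Ltac ord :=
  first [assumption | apply: le_refl | apply: ge_z |
  lazymatch goal with
  | |- le _ _ => apply: le_nn => ?; ord_sat
  | |- ~ le _ _ => move=> ?; ord_sat
  | |- False => ord_sat
  | |- _ /\ _ => split; ord
  | |- @eq I _ _ => apply: le_anti; ord
  end].

Let dense2 x x' y : x ≺ y -> x' ≺ y ->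
  exists w, [/\ x ≺ w, x' ≺ w & w ≺ y].
Proof.
case: (le_total x x') => h h1 h2.
- by case: (dense h2) => w ? ?; exists w; split => //; ord.
- by case: (dense h1) => w ? ?; exists w; split => //; ord.
Qed.

Let dense2r x y y' : x ≺ y -> x ≺ y' ->
  exists w, [/\ x ≺ w, w ≺ y & w ≺ y'].
Proof.
case: (le_total y y') => h h1 h2.
- by case: (dense h1) => w ? ?; exists w; split => //; ord.
- by case: (dense h2) => w ? ?; exists w; split => //; ord.
Qed.

(** * Partitions into points and gaps *)

(** Reading the gap through its germ at [x] makes the letter at a cut depend on that cut alone and
    not on the next one, so inserting a cut leaves the other letters unchanged. *)
Definition right_germ A x : bool :=
  `[< exists2 y, x ≺ y & forall t, x ≺ t -> t ≺ y -> A t >].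

Lemma right_germ_eq A x y b : x ≺ y ->
  (forall t, x ≺ t -> t ≺ y -> `[< A t >] = b) -> right_germ A x = b.
Proof.
move=> xy H; case: b H => H; apply/asboolP.
  by exists y => // t xt ty; apply/asboolP; rewrite H.
move=> [y' xy' H']; have [w [xw wy wy']] := dense2r xy xy'.
by have := H w xw wy; move/asboolP; apply; exact: H'.
Qed.

Fixpoint incr x (s : seq I) : Prop :=
  if s is y :: s' then x ≺ y /\ incr y s' else True.

Fixpoint gap_const A x (s : seq I) : Prop :=
  match s with
  | [::] => forall t, x ≺ t -> `[< A t >] = right_germ A x
  | y :: s' => (forall t, x ≺ t -> t ≺ y -> `[< A t >] = right_germ A x) /\
               gap_const A y s'
  end.

(** Vacuous for an empty list: this treats the last, unbounded gap like the bounded ones. *)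
Definition below t (s : seq I) : Prop := if s is y :: _ then t ≺ y else True.

Lemma exists_below x s : incr x s -> exists2 t, x ≺ t & below t s.
Proof.
case: s => [_|y s [/dense[t]]] /=; last by exists t.
by have [t] := no_max x; exists t.
Qed.

Lemma incr_lt x s t : incr x s -> List.In t s -> x ≺ t.
Proof.
elim: s x => [//|y s IH] x /= [xy iy] [<- //|/(IH _ iy) h]; ord.
Qed.

Lemma gap_const_insert A x s t : gap_const A x s -> x ≺ t -> below t s ->
  [/\ gap_const A x (t :: s), `[< A t >] = right_germ A x &
      right_germ A t = right_germ A x].
Proof.
move=> + xt; case: s => [|y s] /= H ts; [|case: H => H Hs].
- have g : right_germ A t = right_germ A x.
    by have [y ty] := no_max t; apply: (right_germ_eq ty) => u tu _; apply: H; ord.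
  split=> //; last by apply: H.
  split; first by move=> u xu _; apply: H.
  by move=> u tu; rewrite g; apply: H; ord.
- have g : right_germ A t = right_germ A x.
    by apply: (right_germ_eq ts) => u tu uy; apply: H; ord.
  split=> //; last by apply: H.
  split; first by move=> u xu ut; apply: H; ord.
  by split=> // u tu uy; rewrite g; apply: H; ord.
Qed.

Lemma gap_const_tail A x t s :
  gap_const A x (t :: s) -> gap_const A t s.
Proof. by case. Qed.

(** An order-free counterpart of [gap_const]. Enlarging [E] is harmless, so the cuts of several sets
    are merged by concatenation and sorted only afterwards. *)
Definition piecewise A (E : seq I) : Prop :=
  forall t u, le t u -> (forall e, List.In e E -> ~ (le t e /\ le e u)) ->
  A t <-> A u.

Definition pc A : Prop := exists E, piecewise A E.

Lemma piecewise_sub A E E' : (forall e, List.In e E -> List.In e E') ->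
  piecewise A E -> piecewise A E'.
Proof. by move=> sE H t u tu h; apply: H => // e /sE/h. Qed.

Lemma incr_insert x s t : incr x s -> le x t ->
  exists2 s', incr x s' &
    List.In t (x :: s') /\ forall e, List.In e s -> List.In e s'.
Proof.
elim: s x => [|y s IH] x /= => [_ xt|[xy iy] xt].
  have [->|ne] := pselect (t = x); first by exists [::] => //; split=> //; left.
  exists [:: t]; last by split => //; right; left.
  by split=> // tx; apply: ne; ord.
have [->|ne] := pselect (t = x).
  by exists (y :: s) => //; split=> //; left.
have [yt|yt] := pselect (le y t).
  have [s' i' [h1 h2]] := IH y iy yt.
  exists (y :: s') => //; split.
    by right.
  by move=> e /= [->|/h2]; [left|right].
exists (t :: y :: s); last by split; [right; left|move=> e ?; right].
split; first by move=> tx; apply: ne; ord.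
by [].
Qed.

Lemma incr_cover (E : seq I) :
  exists2 s, incr z s & forall e, List.In e E -> List.In e (z :: s).
Proof.
elim: E => [|e E [s i H]]; first by exists [::].
have [s' i' [h1 h2]] := incr_insert i (ge_z e).
exists s' => // d [<- //|/H] /= [->|/h2 ?]; by [left|right].
Qed.

Lemma piecewise_gap_const A E x s : piecewise A E -> incr x s ->
  (forall e, List.In e E -> x ≺ e -> List.In e s) -> gap_const A x s.
Proof.
move=> pA; elim: s x => [|y s IH] x /= => [_ H|[xy iy] H].
- move=> t xt; apply/esym; have [y ty] := no_max t.
  have xy : x ≺ y by ord.
  apply: (right_germ_eq xy) => u xu uy; apply: asbool_equiv_eq.
  case: (le_total t u) => h; [apply: iff_sym|]; apply: pA => // e Ee [? ?].
    by apply: (H e Ee); ord.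
  by apply: (H e Ee); ord.
- have gap e : List.In e E -> x ≺ e -> le y e.
    move=> Ee xe; case: (H e Ee xe) => [->|/(incr_lt iy) ?]; ord.
  split.
    move=> t xt ty; apply/esym; apply: (right_germ_eq xy) => u xu uy.
    apply: asbool_equiv_eq.
    case: (le_total t u) => h; [apply: iff_sym|]; apply: pA => // e Ee [? ?].
      have : le y e by apply: (gap e Ee); ord.
      by move=> ?; ord.
    have : le y e by apply: (gap e Ee); ord.
    by move=> ?; ord.
  apply: IH => // e Ee ye; case: (H e Ee) => //; first by ord.
  by move=> ?; exfalso; ord.
Qed.

Lemma piecewise_incr_gap A E s : piecewise A E -> incr z s ->
  (forall e, List.In e E -> List.In e (z :: s)) -> gap_const A z s.
Proof.
move=> pA i H; apply: piecewise_gap_const pA i _ => e /H [-> h|//].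
by case: h.
Qed.

Lemma exists_gap_const (As : seq (I -> Prop)) :
  (forall A, List.In A As -> pc A) ->
  exists2 s, incr z s & forall A, List.In A As -> gap_const A z s.
Proof.
move=> H; have [E HE] : exists E, forall A, List.In A As -> piecewise A E.
  elim: As H => [|A As IH] H; first by exists [::].
  have [E1 H1] := H A (or_introl erefl).
  have [E2 H2] := IH (fun B h => H B (or_intror h)).
  exists (E1 ++ E2) => B [<-|/(H2 B) h].
    by apply: piecewise_sub H1 => e ?; apply/List.in_or_app; left.
  by apply: piecewise_sub h => e ?; apply/List.in_or_app; right.
have [s i Hs] := incr_cover E.
by exists s => // A /(HE A) pA; apply: piecewise_incr_gap pA i Hs.
Qed.

(** * Stutter-invariant automata *)

Section Automata.

Variable V : eqType.
Implicit Types (al : V -> I -> Prop) (v : V) (vs : seq V).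

(** Letters value all of [V], and finiteness is left to the [support] of an automaton. Automata with
    different supports then read the same words and combine without renaming. *)
Definition letter : Type := (V -> bool) * (V -> bool).

Definition agree vs (l l' : letter) : Prop :=
  {in vs, l.1 =1 l'.1} /\ {in vs, l.2 =1 l'.2}.

Lemma agree_sym vs l l' : agree vs l l' -> agree vs l' l.
Proof. by case=> h1 h2; split=> v ?; rewrite (h1, h2). Qed.

Lemma agree_trans vs l l' l'' : agree vs l l' -> agree vs l' l'' -> agree vs l l''.
Proof.
by case=> h1 h2 [h3 h4]; split=> v ?; rewrite ?(h1, h2) // ?(h3, h4).
Qed.

(* [trans_stutter] makes acceptance independent of the choice of the cut
   points: cutting an open gap adds a letter [(b, b)]. *)
Record dfa := Dfa {
  state : finType;
  trans : state -> letter -> state;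
  init : state;
  final : pred state;
  support : seq V;
  trans_agree : forall q l l', agree support l l' -> trans q l = trans q l';
  trans_stutter : forall q a b, trans (trans q (a, b)) (b, b) = trans q (a, b) }.

Definition letter_at al x : letter :=
  (fun v => `[< al v x >], fun v => right_germ (al v) x).

Definition compat vs al x s : Prop :=
  incr x s /\ forall v, v \in vs -> gap_const (al v) x s.

Definition word al x s : seq letter := map (letter_at al) (x :: s).

Definition run (D : dfa) (q : state D) (w : seq letter) : state D :=
  foldl (@trans D) q w.

Lemma compat_tail vs al x y s : compat vs al x (y :: s) -> compat vs al y s.
Proof. by case=> [[_ ?] H]; split=> // v /H; apply: gap_const_tail. Qed.

Lemma compat_sub vs vs' al x s : {subset vs' <= vs} ->
  compat vs al x s -> compat vs' al x s.
Proof. by move=> sv [i H]; split=> // v /sv/H. Qed.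

Lemma compat_insert vs al x s t : compat vs al x s -> x ≺ t -> below t s ->
  compat vs al x (t :: s) /\
  let b := (letter_at al x).2 in agree vs (letter_at al t) (b, b).
Proof.
move=> [i H] xt ts; split; [split|split].
- by split=> //; case: s i ts {H} => [//|y s] [].
- by move=> v /H h; have [] := gap_const_insert h xt ts.
- by move=> v /H h; have [] := gap_const_insert h xt ts.
- by move=> v /H h; have [] := gap_const_insert h xt ts.
Qed.

Lemma run_insert (D : dfa) (q : state D) al x s t :
  compat (support D) al x s -> x ≺ t -> below t s ->
  run q (word al x (t :: s)) = run q (word al x s).
Proof.
move=> c xt ts; have [_ ag] := compat_insert c xt ts.
by rewrite /run /word /= (trans_agree _ ag) trans_stutter.
Qed.

(** If the first cuts differ, the smaller one is inserted into the other list, which does not change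
    the run. Then both lists start with the same cut; removing it from both decreases the total
    length, since one cut was added and two are dropped. *)
Lemma run_uniq (D : dfa) al x s s' (q : state D) :
  compat (support D) al x s -> compat (support D) al x s' ->
  run q (word al x s) = run q (word al x s').
Proof.
have [n] := ubnP (size s + size s').
elim: n x s s' q => // n IH x s s' q.
have step y r r' : size r + size r' < n ->
    compat (support D) al x (y :: r) -> compat (support D) al x (y :: r') ->
    run q (word al x (y :: r)) = run q (word al x (y :: r')).
  move=> sz /compat_tail c /compat_tail c'.
  exact: (IH y r r' (trans q (letter_at al x))).
case: s s' => [|y s] [|y' s'] // /[!ltnS] sz c c'.
- have xy : x ≺ y' by case: c' => [[]].
  have [c1 _] := compat_insert c xy Logic.I.
  by rewrite -(run_insert q c xy Logic.I); apply: step => //; move: sz => /=; lia.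
- have xy : x ≺ y by case: c => [[]].
  have [c1 _] := compat_insert c' xy Logic.I.
  by rewrite -(run_insert q c' xy Logic.I); apply: step => //; move: sz => /=; lia.
- have [[[xy _] _] [[xy' _] _]] := (c, c').
  have [e|ne] := pselect (y = y').
    by subst y'; apply: step => //; move: sz => /=; lia.
  have [yy'|yy'] := pselect (y ≺ y').
    have [c1 _] := compat_insert c' xy yy'.
    rewrite -(run_insert q c' xy yy'); apply: step => //; move: sz => /=; lia.
  have y'y : y' ≺ y by move/le_nn: yy' => ? ?; apply: ne; ord.
  have [c1 _] := compat_insert c xy' y'y.
  rewrite -(run_insert q c xy' y'y); apply: step => //; move: sz => /=; lia.
Qed.

(** All compatible cuts are quantified over; by [run_uniq] they give the same verdict, and
    [exists_gap_const] provides one. *)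
Definition recognizable (P : (V -> I -> Prop) -> Prop) : Prop :=
  exists D : dfa, forall al, (forall v, pc (al v)) ->
    forall s, compat (support D) al z s ->
    P al <-> final (run (init D) (word al z s)).

Lemma rec_ext (P P' : (V -> I -> Prop) -> Prop) :
  (forall al, (forall v, pc (al v)) -> P al <-> P' al) ->
  recognizable P -> recognizable P'.
Proof.
by move=> e [D H]; exists D => al pal s c; rewrite -e //; apply: H.
Qed.

Lemma rec_not P : recognizable P -> recognizable (fun al => ~ P al).
Proof.
case=> -[Q d q0 F vs h1 h2] H.
exists (Dfa q0 (predC F) h1 h2) => al pal s c.
by have /= -> := H al pal s c; split=> /negP.
Qed.

Lemma rec_and P P' : recognizable P -> recognizable P' ->
  recognizable (fun al => P al /\ P' al).
Proof.
case=> D1 H1 [D2 H2].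
pose d (q : state D1 * state D2) l := (trans q.1 l, trans q.2 l).
have h1 q l l' : agree (support D1 ++ support D2) l l' -> d q l = d q l'.
  case=> h1 h2; congr pair; apply: trans_agree; split=> v hv;
    by rewrite (h1, h2) // mem_cat hv ?orbT.
have h2 q a b : d (d q (a, b)) (b, b) = d q (a, b).
  by rewrite /d /= !trans_stutter.
pose D := @Dfa (state D1 * state D2)%type d (init D1, init D2)
  (fun q => final q.1 && final q.2) (support D1 ++ support D2) h1 h2.
exists D => al pal s c.
have runE (q1 : state D1) (q2 : state D2) (r : seq letter) :
    run ((q1, q2) : state D) r = (run q1 r, run q2 r).
  by elim: r q1 q2 => [//|l r IH] q1 q2; exact: IH.
rewrite [final _]/= runE /=.
rewrite (H1 al pal s) ?(H2 al pal s) /=; first by split=> /andP.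
  by apply: compat_sub c => v hv; rewrite mem_cat hv orbT.
by apply: compat_sub c => v hv; rewrite mem_cat hv.
Qed.

(** * Automata for meeting and for order *)

Lemma letter_at_gap vs al x s t v : compat vs al x s -> x ≺ t -> below t s ->
  v \in vs -> `[< al v t >] = right_germ (al v) x.
Proof.
by move=> c xt ts hv; have [_ [+ _]] := compat_insert c xt ts; apply.
Qed.

Lemma le_below_cases x s t : le x t ->
  [\/ t = x, x ≺ t /\ below t s | exists y s', s = y :: s' /\ le y t].
Proof.
move=> xt; have [->|ne] := pselect (t = x); first by constructor 1.
have {ne} xt' : x ≺ t by move=> tx; apply: ne; ord.
case: s => [|y s]; first by constructor 2.
have [yt|yt] := pselect (le y t); last by constructor 2.
by constructor 3; exists y, s.
Qed.

(** The half-line from [x] splits into the cut, the open gap and the rest. The gap contributes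
    through its germ because it is never empty, by density or by the absence of a greatest
    element. *)
Lemma ex_ge_step (Q : pred (V -> bool)) vs al x s :
  (forall f g, {in vs, f =1 g} -> Q f = Q g) -> compat vs al x s ->
  (exists2 t, le x t & Q (letter_at al t).1) <->
  Q (letter_at al x).1 || Q (letter_at al x).2 \/
  (if s is y :: _ then exists2 t, le y t & Q (letter_at al t).1 else False).
Proof.
move=> Qe c.
have gE t : x ≺ t -> below t s -> Q (letter_at al t).1 = Q (letter_at al x).2.
  by move=> xt ts; apply: Qe => v hv; apply: letter_at_gap c xt ts hv.
split=> [[t xt Qt]|[/orP[Qx|Qx]|]].
- case: (le_below_cases s xt) => [e|[xt' ts]|[y [s' [-> yt]]]].
  + by left; rewrite -e Qt.
  + by left; rewrite -(gE t) // Qt orbT.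
  + by right; exists t.
- by exists x => //; apply: le_refl.
- have [t xt ts] := exists_below c.1.
  by exists t; [ord|rewrite gE].
- case: s c {gE} => [//|y s] [[xy _] _] [t yt Qt].
  by exists t => //; ord.
Qed.

(** With a singleton as one argument this is membership; with equal arguments it is nonemptiness. *)
Lemma rec_meet v1 v2 : recognizable (fun al => exists2 x, al v1 x & al v2 x).
Proof.
pose Q (f : V -> bool) := f v1 && f v2.
have Qe f g : {in [:: v1; v2], f =1 g} -> Q f = Q g.
  by move=> e; rewrite /Q !e // !inE eqxx ?orbT.
pose d q (l : letter) := q || (Q l.1 || Q l.2).
have h1 q l l' : agree [:: v1; v2] l l' -> d q l = d q l'.
  by case=> /Qe e1 /Qe e2; rewrite /d e1 e2.
have h2 q a b : d (d q (a, b)) (b, b) = d q (a, b).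
  by rewrite /d /=; case: (Q a); case: (Q b); case: q.
pose D := Dfa false id h1 h2; exists D => al _ s c.
have main x q r : compat [:: v1; v2] al x r ->
    run (q : state D) (word al x r) <->
    q \/ exists2 t, le x t & Q (letter_at al t).1.
  elim: r x q => [|y r IH] x q cr; rewrite (ex_ge_step Qe cr).
    by split=> [/orP[]|[|[|//]] h]; [left|right; left|apply/orP; left|apply/orP; right].
  have -> : run (q : state D) (word al x (y :: r)) =
    run (d q (letter_at al x) : state D) (word al y r) by [].
  rewrite (IH y _ (compat_tail cr)); split.
    by case=> [/orP[]|]; [left|right; left|right; right].
  by case=> [h|[h|h]]; [left; rewrite /d h|left; rewrite /d h orbT|right].
rewrite [final _]/= (main z (init D) s c) /=; split.
  by case=> t ? ?; right; exists t; [apply: ge_z|rewrite /Q /= !asboolT].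
by case=> // -[t _ /andP[/asboolP ? /asboolP ?]]; exists t.
Qed.

Lemma rec_lt v1 v2 :
  recognizable (fun al => exists x y, [/\ x ≺ y, al v1 x & al v2 y]).
Proof.
(* The first bit records that a point of [v1] has been read, the second that a pair has been found.
   One letter can supply both points when [v2] fills its gap: an open gap contains two points in
   increasing order. *)
pose d (q : bool * bool) (l : letter) :=
  (q.1 || (l.1 v1 || l.2 v1),
   [|| q.2, q.1 && (l.1 v2 || l.2 v2) | (l.1 v1 || l.2 v1) && l.2 v2]).
have h1 q l l' : agree [:: v1; v2] l l' -> d q l = d q l'.
  by case=> e1 e2; rewrite /d !(e1, e2) // !inE eqxx ?orbT.
have h2 q a b : d (d q (a, b)) (b, b) = d q (a, b).
  rewrite /d /=; case: q => p q /=.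
  by case: (a v1); case: (b v1); case: (a v2); case: (b v2); case: p; case: q.
pose D := Dfa (false, false) snd h1 h2; exists D => al _ s c.
have Qe (f g : V -> bool) : {in [:: v1; v2], f =1 g} -> f v2 = g v2.
  by apply; rewrite !inE eqxx orbT.
have main x q r : compat [:: v1; v2] al x r ->
    (run (q : state D) (word al x r)).2 <->
    [\/ q.2, q.1 /\ (exists2 t, le x t & `[< al v2 t >]) |
        exists t u, [/\ le x t, t ≺ u, al v1 t & al v2 u]].
  elim: r x q => [|y r IH] x q cr.
    rewrite (propext (ex_ge_step Qe cr)) /run /=.
    have gE t v : x ≺ t -> v \in [:: v1; v2] ->
        `[< al v t >] = right_germ (al v) x.
      by move=> xt; apply: letter_at_gap cr xt _.
    have v1in : v1 \in [:: v1; v2] by rewrite inE eqxx.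
    have v2in : v2 \in [:: v1; v2] by rewrite !inE eqxx orbT.
    have [t xt] := no_max x; have [t' tt'] := no_max t.
    split.
      case/or3P => [|/andP[? ?]|/andP[/orP[/asboolP h|h] h']].
      + by constructor 1.
      + by constructor 2; split=> //; left.
      + constructor 3; exists x, t; split=> //.
        by apply/asboolP; rewrite gE.
      + constructor 3; exists t, t'; split=> //; first by ord.
          by apply/asboolP; rewrite gE.
        by apply/asboolP; rewrite gE //; ord.
    case=> [->//|[-> [|//]]|[u [u' [xu uu' h h']]]].
      by move->; rewrite orbT.
    have -> : right_germ (al v2) x by rewrite -(gE u') ?asboolT //; ord.
    have [e|ne] := pselect (u = x); first by rewrite -e (asboolT h) /= !orbT.
    have -> : right_germ (al v1) x.
      by rewrite -(gE u) ?asboolT // => ux; apply: ne; ord.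
    by rewrite !orbT.
  have -> : run (q : state D) (word al x (y :: r)) =
    run (d q (letter_at al x) : state D) (word al y r) by [].
  rewrite (propext (IH y _ (compat_tail cr))) (propext (ex_ge_step Qe cr)).
  have gE t v : x ≺ t -> t ≺ y -> v \in [:: v1; v2] ->
      `[< al v t >] = right_germ (al v) x.
    by move=> xt ty; apply: letter_at_gap cr xt ty.
  have v1in : v1 \in [:: v1; v2] by rewrite inE eqxx.
  have v2in : v2 \in [:: v1; v2] by rewrite !inE eqxx orbT.
  have [[xy _] _] := cr.
  have [t xt ty] := dense xy; have [t' tt' t'y] := dense ty.
  have xt' : x ≺ t' by ord.
  rewrite /d /=; split.
    case=> [/or3P[|/andP[? ?]|/andP[/orP[/asboolP h|h] h']]||].
    + by constructor 1.
    + by constructor 2; split=> //; left.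
    + constructor 3; exists x, t; split=> //.
      by apply/asboolP; rewrite gE.
    + constructor 3; exists t, t'; split=> //; first by ord.
        by apply/asboolP; rewrite gE.
      by apply/asboolP; rewrite gE.
    + case=> /or3P[p|/asboolP h|h] [u yu /asboolP h'].
      * by constructor 2; split=> //; right; exists u => //; apply/asboolP.
      * by constructor 3; exists x, u; split=> //; ord.
      * constructor 3; exists t, u; split=> //; [ord|ord|].
        by apply/asboolP; rewrite gE.
    + by case=> u [u' [? ? ? ?]]; constructor 3; exists u, u'; split=> //; ord.
  case=> [->|[-> [h|h]]|[u [u' [xu uu' h h']]]].
  - by constructor 1.
  - by constructor 1; rewrite h orbT.
  - by constructor 2.
  have [yu|uy] := pselect (le y u); first by constructor 3; exists u, u'.
  have h1x : `[< al v1 x >] || right_germ (al v1) x.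
    have [e|ne] := pselect (u = x); first by rewrite -e asboolT.
    by rewrite -(gE u) ?(asboolT h) ?orbT // => ux; apply: ne; ord.
  have [yu'|u'y] := pselect (le y u').
    constructor 2; split; first by rewrite h1x orbT.
    by exists u' => //; apply/asboolP.
  constructor 1; rewrite h1x -(gE u') ?(asboolT h') ?orbT //; ord.
rewrite [final _]/= (main z (init D) s c) /=; split.
  by case=> t [u [? ? ?]]; constructor 3; exists t, u; split => //; apply: ge_z.
by case=> // [[]//|[t [u [_ ? ? ?]]]]; exists t, u.
Qed.

End Automata.

(** * Finite unions of closed intervals *)

Local Notation cints := (cint_set I le).
Local Notation fci := (fci I le).
Local Notation covers l t := (exists c, List.In c l /\ cints c t).

Definition ends (c : cint I) : seq I :=
  match c with Icc i j => [:: i; j] | Ici i => [:: i] | Iic j => [:: j] end.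

Lemma fci_pc A : fci A -> pc A.
Proof.
case=> l Al; exists (flatten (map ends l)) => t u tu H.
have ends_l c e : List.In c l -> List.In e (ends c) ->
    List.In e (flatten (map ends l)).
  elim: l {Al H} => [//|c' l IH] /= [->|h] h'; apply/List.in_or_app; first by left.
  by right; apply: IH.
have key c : List.In c l -> cints c t <-> cints c u.
  move=> cl; have nb e : List.In e (ends c) -> le t e -> le e u -> False.
    by move=> h ? ?; apply: (H e (ends_l c e cl h)).
  case: c nb {cl} => [i j|i|j] /= nb.
  - have nbi := nb i (or_introl erefl).
    have nbj := nb j (or_intror (or_introl erefl)).
    split=> -[h1 h2]; split.
    + by ord.
    + by apply: le_nn => uj; apply: nbj; ord.
    + by apply: le_nn => ti; apply: nbi; ord.
    + by ord.
  - have nbi := nb i (or_introl erefl).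
    split=> h; first by ord.
    by apply: le_nn => ti; apply: nbi; ord.
  - have nbj := nb j (or_introl erefl).
    split=> h; last by ord.
    by apply: le_nn => uj; apply: nbj; ord.
by rewrite !Al; split=> -[c [cl /(key c cl) h]]; exists c.
Qed.

(** One half of the openness of the complement: each interval of the list that misses [y] leaves
    free some stretch to the left of [y], and finitely many such stretches have a common part. *)
Lemma avoid_left (l : seq (cint I)) x y : x ≺ y -> ~ covers l y ->
  exists w, [/\ le x w, w ≺ y & forall t, w ≺ t -> t ≺ y -> ~ covers l t].
Proof.
move=> xy; elim: l => [_|c l IH nc].
  by exists x; split=> // t _ _ [c []].
have [|w [xw wy H]] := IH.
  by case=> d [dl dy]; apply: nc; exists d; split=> //; right.
have nc' : ~ cints c y by move=> cy; apply: nc; exists c; split=> //; left.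
have [w' [ww' w'y H']] : exists w', [/\ le w w', w' ≺ y &
    forall t, w' ≺ t -> t ≺ y -> ~ cints c t].
  have simple : (forall t, t ≺ y -> ~ cints c t) -> exists w', [/\ le w w',
      w' ≺ y & forall t, w' ≺ t -> t ≺ y -> ~ cints c t].
    by move=> h; exists w; split=> // t _; apply: h.
  have beyond j : (forall t, cints c t -> le t j) -> j ≺ y -> exists w',
      [/\ le w w', w' ≺ y & forall t, w' ≺ t -> t ≺ y -> ~ cints c t].
    move=> h jy; case: (le_total w j) => wj; [exists j|exists w];
      split=> // t ht _ /h ?; ord.
  case: c nc' {nc} simple beyond => [i j|i|j] /= nc' simple beyond.
  - have [yi|yi] := pselect (y ≺ i).
      by apply: simple => t ty [? ?]; ord.
    apply: (beyond j); first by move=> t [].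
    by move=> yj; apply: nc'; split => //; apply: le_nn.
  - by apply: simple => t ty it; apply: nc'; ord.
  - by apply: (beyond j).
exists w'; split=> //; first by ord.
move=> t w't ty [d [[<-|dl] dt]]; first by apply: (H' t).
by apply: (H t) => //; [ord|exists d].
Qed.

Lemma avoid_right (l : seq (cint I)) x y : x ≺ y -> ~ covers l x ->
  exists w, [/\ x ≺ w, le w y & forall t, x ≺ t -> t ≺ w -> ~ covers l t].
Proof.
move=> xy; elim: l => [_|c l IH nc].
  by exists y; split=> // t _ _ [c []].
have [|w [xw wy H]] := IH.
  by case=> d [dl dy]; apply: nc; exists d; split=> //; right.
have nc' : ~ cints c x by move=> cx; apply: nc; exists c; split=> //; left.
have [w' [ww' w'y H']] : exists w', [/\ x ≺ w', le w' w &
    forall t, x ≺ t -> t ≺ w' -> ~ cints c t].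
  have simple : (forall t, x ≺ t -> ~ cints c t) -> exists w', [/\ x ≺ w',
      le w' w & forall t, x ≺ t -> t ≺ w' -> ~ cints c t].
    by move=> h; exists w; split=> // t ? _; apply: h.
  have before i : (forall t, cints c t -> le i t) -> x ≺ i -> exists w',
      [/\ x ≺ w', le w' w & forall t, x ≺ t -> t ≺ w' -> ~ cints c t].
    move=> h xi; case: (le_total w i) => wi; [exists w|exists i];
      split=> // t _ ht /h ?; ord.
  case: c nc' {nc} simple before => [i j|i|j] /= nc' simple before.
  - have [jx|jx] := pselect (j ≺ x).
      by apply: simple => t ty [? ?]; ord.
    apply: (before i); first by move=> t [].
    by move=> ix; apply: nc'; split => //; apply: le_nn.
  - by apply: (before i).
  - by apply: simple => t ty it; apply: nc'; ord.
exists w'; split=> //; first by ord.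
move=> t w't ty [d [[<-|dl] dt]]; first by apply: (H' t).
by apply: (H t) => //; [ord|exists d].
Qed.

(** An end outside [A] would have a stretch free of [A] on the side of the gap, and density puts a
    point of the gap there. *)
Lemma fci_closed A x y : fci A -> x ≺ y ->
  (forall t, x ≺ t -> t ≺ y -> A t) -> A x /\ A y.
Proof.
case=> l Al xy H; split; apply: contrapT => /Al.
  case/(avoid_right xy) => w [xw wy nl]; have [t xt tw] := dense xw.
  by apply: (nl t xt tw); apply/Al; apply: H; ord.
case/(avoid_left xy) => w [xw wy nl]; have [t wt ty] := dense wy.
by apply: (nl t wt ty); apply/Al; apply: H; ord.
Qed.

Section Fci.

Variable V : eqType.

(** A piecewise constant set is a finite union of closed intervals exactly when it contains the ends
    of every gap it fills. The first bit of the state carries the value on the preceding gap,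
    initially false because nothing precedes [z]; the second bit records that no violation has
    occurred. *)
Lemma rec_fci (v : V) : recognizable (fun al => fci (al v)).
Proof.
pose d (q : bool * bool) (l : letter V) :=
  (l.2 v, [&& q.2, q.1 ==> l.1 v & l.2 v ==> l.1 v]).
have h1 q l l' : agree [:: v] l l' -> d q l = d q l'.
  by case=> e1 e2; rewrite /d !(e1, e2) // !inE eqxx ?orbT.
have h2 q a b : d (d q (a, b)) (b, b) = d q (a, b).
  by rewrite /d /=; case: (b v); rewrite /= !andbT.
pose D := Dfa (false, true) snd h1 h2; exists D => al _ s [i c].
have {}c := c v (mem_head _ _).
rewrite [final _]/=; split.
  move=> fA; have {fA} closed := fci_closed fA.
  have main (q : bool * bool) x r : incr x r -> gap_const (al v) x r -> q.2 ->
      (q.1 -> al v x) -> (run (q : state D) (word al x r)).2.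
    elim: r x q => [|y r IH] x q /= ir cr q2 q1.
      rewrite /run /= q2 /=; apply/andP; split; apply/implyP.
        by move/q1 => ?; apply/asboolP.
      move=> g; apply/asboolP; have [y xy] := no_max x.
      by case: (closed x y xy) => // t xt _; apply/asboolP; rewrite cr.
    case: ir cr => xy iy [cxy cy].
    have gA : right_germ (al v) x -> al v x /\ al v y.
      move=> g; apply: closed => // t xt ty; apply/asboolP; by rewrite cxy.
    change (is_true (run (d q (letter_at al x) : state D) (word al y r)).2).
    apply: IH => //=; last by case/gA.
    rewrite q2 /=; apply/andP; split; apply/implyP.
      by move/q1 => ?; apply/asboolP.
    by case/gA => ? _; apply/asboolP.
  exact: main.
have main (q : bool * bool) x r : incr x r -> gap_const (al v) x r ->
    (run (q : state D) (word al x r)).2 ->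
    [/\ q.2, q.1 -> al v x &
        exists l, forall t, covers l t <-> le x t /\ al v t].
  elim: r x q => [|y r IH] x q /= ir cr.
    rewrite /run /= => /and3P[-> /implyP q1 /implyP g1]; split => //.
      by move/q1/asboolP.
    have [Ax|Ax] := pselect (al v x); last first.
      exists [::] => t; split=> [[k []]//|[xt At]]; exfalso.
      have {} xt : x ≺ t by move=> tx; have e : t = x by [ord]; subst t.
      by apply: Ax; apply/asboolP/g1; rewrite -(cr t) //; apply/asboolP.
    have [g|g] := boolP (right_germ (al v) x).
      exists [:: Ici I x] => t; split.
        case=> k [[<-|//] /= xt]; split=> //.
        have [e|ne] := pselect (t = x); first by subst t.
        by apply/asboolP; rewrite cr // => tx; apply: ne; ord.
      by case=> xt _; exists (Ici I x); split=> //; left.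
    exists [:: Icc I x x] => t; split.
      case=> k [[<-|//] /= [xt tx]]; have -> : t = x by ord.
      by split.
    case=> xt At; exists (Icc I x x); split; first by left.
    split=> //; apply: contrapT => tx.
    by move: g; rewrite -(cr t) // (asboolT At).
  case: ir cr => xy iy [cxy cy].
  move=> h; have {h} /(IH _ _ iy cy) :
    (run (d q (letter_at al x) : state D) (word al y r)).2 := h.
  case=> /and3P[q2 /implyP q1 /implyP g1] gy [l Hl].
  split=> //; first by move/q1/asboolP.
  have gap t : x ≺ t -> t ≺ y -> al v t <-> right_germ (al v) x.
    by move=> xt ty; rewrite -(cxy t xt ty); split=> /asboolP.
  exists ((if `[< al v x >] then [:: Icc I x x] else [::]) ++
     (if right_germ (al v) x then [:: Icc I x y] else [::]) ++ l) => t.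
  split.
    case=> k [kin kt]; case: (List.in_app_or _ _ _ kin) => {}kin.
      case: ifP kin => // /asboolP Ax [e|//]; subst k; case: kt => xt tx.
      by have -> : t = x by [ord]; split.
    case: (List.in_app_or _ _ _ kin) => {}kin.
      case: ifP kin => // g [e|//]; subst k; case: kt => xt ty; split=> //.
      have [e|ne] := pselect (t = x); first by subst t; apply/asboolP/g1.
      have [e|ne'] := pselect (t = y); first by subst t; apply: gy.
      by apply/gap => // h; [apply: ne|apply: ne']; ord.
    have [yt At] : le y t /\ al v t by apply/Hl; exists k.
    by split=> //; ord.
  case=> xt At; have [yt|ty] := pselect (le y t).
    have [k [kl kt]] : covers l t by apply/Hl.
    by exists k; split=> //; apply/List.in_or_app; right; apply/List.in_or_app; right.
  have [e|ne] := pselect (t = x).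
    subst t; exists (Icc I x x); rewrite (asboolT At).
    by split; [left|split].
  have xt' : x ≺ t by move=> ?; apply: ne; ord.
  exists (Icc I x y); split; last by split=> //; ord.
  have -> : right_germ (al v) x by apply/(gap t).
  by apply/List.in_or_app; right; left.
case/(main _ _ _ i c) => _ _ [l Hl]; exists l => x; rewrite Hl.
by split=> [|[]].
Qed.

(** * Projection *)

Definition upd (al : V -> I -> Prop) (v : V) A : V -> I -> Prop :=
  fun v' => if v' == v then A else al v'.

Section Projection.

Variables (v : V) (D : dfa V).
Implicit Types (al : V -> I -> Prop) (l m : letter V) (d : seq (I * letter V)).

Let vs' := [seq v' <- support D | v' != v].

(* [l] is a letter of the projected word; in a set [A] for the variable [v]
   the gap after it may have to be cut finitely often, which spells a word
   [l0 :: ls]. *)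
Definition lifts l q q' : Prop := exists l0 ls,
  [/\ agree vs' l0 l, forall m, List.In m ls -> agree vs' m (l.2, l.2) &
      q' = run (D := D) q (l0 :: ls)].

Definition proj_trans (S : {set state D}) l : {set state D} :=
  [set q' | `[< exists2 q, q \in S & lifts l q q' >]].

Lemma proj_trans_agree S l l' : agree vs' l l' -> proj_trans S l = proj_trans S l'.
Proof.
move=> e; have sub k k' q q' : agree vs' k k' -> lifts k q q' -> lifts k' q q'.
  move=> ekk [l0 [ls [h0 hs ->]]]; exists l0, ls; split=> // [|m hm].
    exact: agree_trans ekk.
  by apply: agree_trans (hs m hm) _; case: ekk => _ h2; split.
apply/setP => q'; rewrite !inE; apply: asbool_equiv_eq.
split=> -[q qS h]; exists q => //; first exact: sub h.
by apply: sub h; apply: agree_sym.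
Qed.

(** Two successive lifts concatenate to a single one. Conversely, a lift is followed by the
    stuttering letter built from the gap values of its last letter, which [D] absorbs. *)
Lemma proj_trans_stutter S a b :
  proj_trans (proj_trans S (a, b)) (b, b) = proj_trans S (a, b).
Proof.
apply/setP => q'; rewrite !inE; apply: asbool_equiv_eq; split.
  case=> q1; rewrite inE => /asboolP[q qS [l0 [ls [h0 hs ->]]]].
  case=> [m0 [ms [k0 ks ->]]]; exists q => //; exists l0, (ls ++ m0 :: ms).
  split=> //; last by rewrite /run -cat_cons foldl_cat.
  move=> m hm; case: (List.in_app_or _ _ _ hm) => [|[<-|]] //.
    exact: hs.
  exact: ks.
case=> q qS [l0 [ls [h0 hs ->]]]; exists (run q (l0 :: ls)).
  by rewrite inE; apply/asboolP; exists q => //; exists l0, ls.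
have [[x y] [eq ag]] : exists m : letter V,
    run q (l0 :: ls) = run (D := D) (run q (l0 :: ls)) [:: (m.2, m.2)] /\
    agree vs' (m.2, m.2) (b, b).
  case/lastP: ls hs => [|ls m] hs.
    exists l0; case: l0 h0 => x y [_ h2]; split; last by split.
    by rewrite /run /= trans_stutter.
  exists m; have [_ h2] : agree vs' m (b, b).
    by apply: hs; rewrite -cats1; apply/List.in_or_app; right; left.
  split; last by split.
  rewrite /run /= foldl_rcons; case: m {hs h2} => x y /=.
  by rewrite trans_stutter.
by exists (y, y), [::]; split.
Qed.

Definition proj_dfa : dfa V :=
  Dfa [set init D] (fun S : {set _} => [exists q in S, final q])
      proj_trans_agree proj_trans_stutter.

Fixpoint lift_path q (r : seq (letter V)) q' : Prop :=
  if r is l :: r' then exists2 q1, lifts l q q1 & lift_path q1 r' q'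
  else q' = q.

Lemma mem_run_proj (r : seq (letter V)) (S : {set state D}) q' :
  q' \in (run (D := proj_dfa) S r : {set state D}) <->
  exists2 q, q \in S & lift_path q r q'.
Proof.
elim: r S => [|l r IH] S /=.
  by split=> [h|[q qS ->//]]; exists q'.
rewrite (IH (proj_trans S l)); split.
  case=> q1; rewrite inE => /asboolP[q qS h] h'.
  by exists q => //; exists q1.
case=> q qS [q1 h h']; exists q1 => //.
by rewrite inE; apply/asboolP; exists q.
Qed.

(** The list [d] pairs each further cut with the letter to be read there. Off [v] the letters are
    those of [al]; at [v] they prescribe the set still to be constructed. *)
Fixpoint matches al x l d : Prop :=
  agree vs' l (letter_at al x) /\
  match d with
  | [::] => True
  | (y, m) :: d' => x ≺ y /\ matches al y m d'
  end.

(* A lifted run becomes a finer partition: the extra letters are read at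
   points inserted in the gaps. *)
Lemma lift_path_matches al x s q q' : compat vs' al x s ->
  lift_path q (word al x s) q' ->
  exists l d, [/\ matches al x l d, compat vs' al x (map fst d) &
                  q' = run (D := D) q (l :: map snd d)].
Proof.
elim: s x q => [|y s IHs] x q c [q1 [l0 [ls [h0 hs ->]]] hq].
  have inner : forall ls x l0 q, compat vs' al x [::] ->
      agree vs' l0 (letter_at al x) ->
      (forall m, List.In m ls ->
         agree vs' m ((letter_at al x).2, (letter_at al x).2)) ->
      exists d, [/\ matches al x l0 d, compat vs' al x (map fst d) &
                    run (D := D) q (l0 :: ls) = run q (l0 :: map snd d)].
    elim=> {c h0 hs x l0 q ls hq} [|m ls IH] x l0 q c h0 hs.
      by exists [::].
    have [t xt ts] := exists_below c.1.
    have [c1 ag] := compat_insert c xt ts.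
    have [|m' lm'|d [h1 h2 h3]] := IH t m (trans q l0) (compat_tail c1).
    - by apply: agree_trans (hs m (or_introl erefl)) _; apply: agree_sym.
    - apply: agree_trans (hs m' (or_intror lm')) _; apply: agree_sym.
      by case: ag => _ ag; split.
    exists ((t, m) :: d); split=> //.
    split; first by split=> //; case: h2.
    move=> v' hv; split; last by case: h2 => _; apply.
    by move=> u xu ut; rewrite (letter_at_gap c xu).
  have [d [h1 h2 h3]] := inner ls x l0 q c h0 hs.
  by exists l0, d; split=> //; rewrite -h3.
have inner : forall ls x l0 q, compat vs' al x (y :: s) ->
    agree vs' l0 (letter_at al x) ->
    (forall m, List.In m ls ->
       agree vs' m ((letter_at al x).2, (letter_at al x).2)) ->
    lift_path (run q (l0 :: ls)) (word al y s) q' ->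
    exists d, [/\ matches al x l0 d, compat vs' al x (map fst d) &
                  q' = run (D := D) q (l0 :: map snd d)].
  elim=> {c h0 hs x l0 q ls hq} [|m ls IH] x l0 q c h0 hs hq.
    have [l [d [h1 h2 ->]]] := IHs y _ (compat_tail c) hq.
    case: c => [[xy _] c].
    exists ((y, l) :: d); split=> //; split; first by split=> //; case: h2.
    by move=> v' hv; split; [case: (c v' hv)|case: h2 => _; apply].
  have [t xt ts] := exists_below c.1.
  have [c1 ag] := compat_insert c xt ts.
  have [|m' lm'|//|d [h1 h2 h3]] := IH t m (trans q l0) (compat_tail c1).
  - by apply: agree_trans (hs m (or_introl erefl)) _; apply: agree_sym.
  - apply: agree_trans (hs m' (or_intror lm')) _; apply: agree_sym.
    by case: ag => _ ag; split.
  exists ((t, m) :: d); split=> //.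
  split; first by split=> //; case: h2.
  move=> v' hv; split; last by case: h2 => _; apply.
  by move=> u xu ut; rewrite (letter_at_gap c xu) //=; move: ts => /= ?; ord.
by have [d [? ? ->]] := inner ls x l0 q c h0 hs hq; exists l0, d.
Qed.

(** The step function with the values that the letters prescribe at [v], equal to [b] before the
    first cut. It need not be closed, which is why [recognizable] and [rec_ex] range over [pc]
    sets. *)
Fixpoint realize (b : bool) d t : bool :=
  if d is (y, m) :: d' then
    if `[< t ≺ y >] then b else
    if `[< t = y >] then m.1 v else realize (m.2 v) d' t
  else b.

Lemma realize_piecewise b d : piecewise (realize b d) (map fst d).
Proof.
move=> t u tu; elim: d b => [//|[y m] d IH] b H /=.
have [ty|yt] := pselect (t ≺ y).
  have uy : u ≺ y by move=> yu; apply: (H y); [left|split=> //; ord].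
  by rewrite !asboolT.
move/le_nn: yt => yt; have {}yt : y ≺ t.
  by move=> ty; apply: (H y); [left|split=> //; ord].
have ne w : le t w -> w <> y by move=> tw e; subst w; ord.
rewrite (asboolF (ne t (le_refl t))) (asboolF (ne u tu)).
have nlt w : le t w -> ~ w ≺ y by move=> tw; apply; ord.
rewrite (asboolF (nlt t (le_refl t))) (asboolF (nlt u tu)).
by apply: IH => e ed; apply: H; right.
Qed.

Lemma run_realize al x l d A q : matches al x l d -> compat vs' al x (map fst d) ->
  `[< A x >] = l.1 v ->
  (forall t, x ≺ t -> `[< A t >] = realize (l.2 v) d t) ->
  compat (support D) (upd al v A) x (map fst d) /\
  run (D := D) q (word (upd al v A) x (map fst d)) = run q (l :: map snd d).
Proof.
have up (w : V) : w \in support D -> w != v -> w \in vs'.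
  by move=> ? ?; rewrite mem_filter; apply/andP.
have ag x1 (l1 : letter V) : agree vs' l1 (letter_at al x1) ->
    `[< A x1 >] = l1.1 v -> right_germ A x1 = l1.2 v ->
    agree (support D) (letter_at (upd al v A) x1) l1.
  move=> [h1 h2] e1 e2; split=> w hw; rewrite /= /upd;
    by case: eqVneq => [->//|ne]; rewrite (h1, h2) ?up.
elim: d x l q => [|[y m] d IH] x l q /=.
  move=> [hl _] c e1 e2; have [y xy] := no_max x.
  have g : right_germ A x = l.2 v by apply: (right_germ_eq xy) => t xt _; exact: e2.
  split; last by rewrite /run /=; apply: trans_agree; apply: ag.
  split=> // w hw /=; rewrite /upd; case: eqVneq => [_|ne] t xt.
    by rewrite g e2.
  by case: c => _ /(_ w (up w hw ne)) /=; apply.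
move=> [hl [xy hm]] c e1 e2.
have e2' t : x ≺ t -> t ≺ y -> `[< A t >] = l.2 v.
  by move=> xt ty; rewrite e2 // (asboolT ty).
have g : right_germ A x = l.2 v by apply: (right_germ_eq xy).
have [||c' r] := IH y m (trans q l) hm (compat_tail c).
- rewrite e2 // (asboolF (_ : ~ y ≺ y)); last by apply.
  by rewrite (asboolT (erefl y)).
- move=> t yt; rewrite e2; last by ord.
  rewrite (asboolF (_ : ~ t ≺ y)); last by apply; ord.
  by rewrite (asboolF (_ : t <> y)) // => e; subst t; ord.
split; last first.
  have e : trans q (letter_at (upd al v A) x) = trans q l.
    by apply: trans_agree; apply: ag.
  by rewrite -[RHS]r -e.
split; first by split=> //; case: c'.
move=> w hw; split; last by case: c' => _; apply.
move=> t xt ty; rewrite /upd; case: eqVneq => [_|ne]; first by rewrite g e2'.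
by case: c => _ /(_ w (up w hw ne)) [+ _]; apply.
Qed.

End Projection.

Lemma rec_ex v (P : (V -> I -> Prop) -> Prop) : recognizable P ->
  recognizable (fun al => exists2 A, pc A & P (upd al v A)).
Proof.
case=> D H; exists (proj_dfa v D) => al pal s c.
have pcu A : pc A -> forall w : V, pc (upd al v A w).
  by move=> pA w; rewrite /upd; case: ifP.
split.
- case=> A pA PA.
  (* The given cuts need not suit [A]. On cuts that suit all the sets, every letter of the projected
     word lifts to a single letter. *)
  have [|s' i' gc] := @exists_gap_const (A :: map al (support D)).
    move=> B [<-//|h]; suff [w -> //] : exists w : V, B = al w.
    elim: (support D) h => [//|w vs IH] /= [<-|/IH//]; by exists w.
  have mem (w : V) : w \in support D -> gap_const (al w) z s'.
    move=> hw; apply: gc; right.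
    elim: (support D) hw => [//|w' vs IH] /=; rewrite inE.
    by case/predU1P => [->|/IH]; [left|right].
  have c1 : compat (support (proj_dfa v D)) al z s'.
    by split=> // w; rewrite mem_filter => /andP[_ /mem].
  have c2 : compat (support D) (upd al v A) z s'.
    split=> // w hw; rewrite /upd; case: ifP => _; [apply: gc; left|exact: mem].
    by [].
  rewrite (run_uniq _ c c1); apply/existsP.
  exists (run (init D) (word (upd al v A) z s')).
  apply/andP; split; last by apply/(H _ (pcu A pA)).
  apply/mem_run_proj; exists (init D); first by rewrite inE.
  have agr x : agree [seq w <- support D | w != v] (letter_at (upd al v A) x)
      (letter_at al x).
    by split=> w; rewrite mem_filter /= /upd => /andP[/negbTE-> _].
  rewrite /word; elim: (z :: s') (init D) => [//|x r IH] q /=.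
  exists (trans q (letter_at (upd al v A) x)); last exact: IH.
  by exists (letter_at (upd al v A) x), [::]; split.
- case/existsP => q' /andP[/mem_run_proj[q]]; rewrite inE => /eqP->.
  case/(lift_path_matches c) => l [d [h1 h2 ->]] F.
  (* The initial value [false] is never taken, as no point precedes [z]. *)
  pose A t : Prop := realize v false ((z, l) :: d) t.
  have nz t : ~ t ≺ z by apply; apply: ge_z.
  have [||c' r] := run_realize (A := A) (init D) h1 h2.
  + by rewrite /A /= (asboolF (nz z)) (asboolT (erefl z)) asboolb.
  + move=> t zt; rewrite /A /= (asboolF (nz t)) asboolb asboolF //.
    by move=> e; subst t; ord.
  have pA : pc A by exists (map fst ((z, l) :: d)); apply: realize_piecewise.
  exists A => //; apply/(H _ (pcu A pA) _ c').
  by rewrite r.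
Qed.

Definition singleton A : Prop := exists x, forall y, A y <-> y = x.

Lemma rec_singleton (v : V) : recognizable (fun al => singleton (al v)).
Proof.
apply: rec_ext (rec_and (rec_meet v v) (rec_not (rec_lt v v))) => al _; split.
  case=> [[x Ax _] H]; exists x => y; split=> [Ay|->//].
  by apply: le_anti; apply: le_nn => h; apply: H; [exists x, y|exists y, x].
case=> x Ax; have Axx : al v x by apply/Ax.
split; first by exists x.
by case=> y [y' [yy' /Ax ? /Ax ?]]; subst; ord.
Qed.

End Fci.

(** * Definable relations between sets and points *)

Implicit Types (rho : nat -> I -> Prop) (e : nat -> I).

(** As in the automata treatment of monadic second-order logic, element variables become singletons,
    so that one kind of automaton serves both sorts. *)
Definition encode rho e (v : nat + nat) : I -> Prop :=
  match v with inl n => rho n | inr i => fun x => x = e i end.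

Definition upd_point e i x : nat -> I := fun j => if j == i then x else e j.

Definition definable (R : (nat -> I -> Prop) -> (nat -> I) -> Prop) : Prop :=
  exists2 P, recognizable P & forall rho e, (forall n, fci (rho n)) ->
    P (encode rho e) <-> R rho e.

Lemma def_ext (R R' : (nat -> I -> Prop) -> (nat -> I) -> Prop) :
  (forall rho e, (forall n, fci (rho n)) -> R rho e <-> R' rho e) ->
  definable R -> definable R'.
Proof.
by move=> H [P recP h]; exists P => // rho e fr; rewrite h // H.
Qed.

Lemma def_not R : definable R -> definable (fun rho e => ~ R rho e).
Proof.
case=> P recP h; exists (fun al => ~ P al); first exact: rec_not.
by move=> rho e fr; rewrite h.
Qed.

Lemma def_and R R' : definable R -> definable R' ->
  definable (fun rho e => R rho e /\ R' rho e).
Proof.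
case=> P recP h [P' recP' h']; exists (fun al => P al /\ P' al).
  exact: rec_and.
by move=> rho e fr; rewrite h // h'.
Qed.

Lemma def_imp R R' : definable R -> definable R' ->
  definable (fun rho e => R rho e -> R' rho e).
Proof.
move=> dR /def_not/(def_and dR)/def_not; apply: def_ext => rho e _.
by split=> [H r|H [/H]//]; apply: contrapT => r'; apply: H.
Qed.

Lemma def_or R R' : definable R -> definable R' ->
  definable (fun rho e => R rho e \/ R' rho e).
Proof.
move=> /def_not dR dR'; apply: def_ext (def_imp dR dR') => rho e _.
split=> [H|[r|r'] //]; have [r|r] := pselect (R rho e); first by left.
by right; apply: H.
Qed.

(** Projection quantifies over all piecewise constant sets; intersecting with [rec_fci] before
    projecting restricts the witness to the universe. *)
Lemma def_exists_set n R : definable R ->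
  definable (fun rho e => exists A, fci A /\ R (update I rho n A) e).
Proof.
case=> P recP h.
exists (fun al => exists2 A, pc A & fci (upd al (inl n) A (inl n)) /\
   P (upd al (inl n) A)).
  by apply: (rec_ex (inl n) (rec_and (rec_fci (inl n)) recP)).
move=> rho e fr.
have updE A : upd (encode rho e) (inl n) A = encode (update I rho n A) e.
  apply: funext => -[m|//]; rewrite /upd /update.
  by rewrite [inl m == _](_ : _ = (m == n)).
have fu A : fci A -> forall m, fci (update I rho n A m).
  by move=> fA m; rewrite /update; case: ifP.
split=> [[A _ []]|[A [fA RA]]].
  rewrite {1}/upd eqxx updE => fA PA; exists A; split=> //.
  by apply/h => //; apply: fu.
exists A; first exact: fci_pc.
by rewrite {1}/upd eqxx updE; split=> //; apply/h => //; apply: fu.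
Qed.

Lemma def_exists_point i R : definable R ->
  definable (fun rho e => exists x, R rho (upd_point e i x)).
Proof.
case=> P recP h.
exists (fun al => exists2 A, pc A & singleton (upd al (inr i) A (inr i)) /\
   P (upd al (inr i) A)).
  by apply: (rec_ex (inr i) (rec_and (rec_singleton (inr i)) recP)).
move=> rho e fr.
have updE x : upd (encode rho e) (inr i) (fun y => y = x) =
    encode rho (upd_point e i x).
  apply: funext => -[//|j]; rewrite /upd /= /upd_point.
  rewrite [inr j == _](_ : _ = (j == i)) //.
  by case: ifP.
split=> [[A _ []]|[x Rx]].
  rewrite {1}/upd eqxx => -[x Ax].
  have -> : A = (fun y => y = x) by apply: funext => y; apply/propext.
  by rewrite updE => /(h rho _ fr); exists x.
exists (fun y => y = x).
  apply: fci_pc; exists [:: Icc I x x] => y; split=> [->|].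
    by exists (Icc I x x); split; [left|split].
  by case=> c [[<-|//] [? ?]]; ord.
rewrite {1}/upd eqxx updE; split; first by exists x.
by apply/h.
Qed.

Lemma def_mem n i : definable (fun rho e => rho n (e i)).
Proof.
exists (fun al : nat + nat -> _ => exists2 x, al (inl n) x & al (inr i) x).
  exact: rec_meet.
by move=> rho e _; split=> [[x ? <-//]|]; exists (e i).
Qed.

Lemma def_lt i j : definable (fun rho e => e i ≺ e j).
Proof.
exists (fun al : nat + nat -> _ =>
  exists x y, [/\ x ≺ y, al (inr i) x & al (inr j) y]); first exact: rec_lt.
by move=> rho e _; split=> [[x [y [? <- <-//]]]|]; exists (e i), (e j).
Qed.

(** * Endpoints and terms *)

Lemma fci_ext A B : (forall x, A x <-> B x) -> fci A -> fci B.
Proof. by move=> AB [l H]; exists l => x; rewrite -AB. Qed.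

Lemma fci_union A B : fci A -> fci B -> fci (s_union I A B).
Proof.
case=> l Hl [l' Hl']; exists (l ++ l') => x; rewrite /s_union Hl Hl'; split.
  by case=> -[c [h ?]]; exists c; split=> //; apply/List.in_or_app; [left|right].
by case=> c [/(List.in_app_or _ _ _) [] ? ?]; [left|right]; exists c.
Qed.

Lemma fci_bot : fci (s_bot I).
Proof. by exists [::] => x; split=> // -[c []]. Qed.

Lemma fci_cint c : fci (cints c).
Proof. by exists [:: c] => x; split=> [|[d [[<-|//] ?]]] //; exists c; split=> //; left. Qed.

Lemma fci_finite A (E : seq I) : (forall x, A x -> List.In x E) -> fci A.
Proof.
elim: E A => [|y E IH] A AE; first by apply: fci_ext fci_bot => x; split=> [//|/AE].
have fB : fci (fun x => A x /\ x <> y).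
  by apply: IH => x [/AE /= [->|//]].
have [Ay|Ay] := pselect (A y).
  apply: fci_ext (fci_union fB (fci_cint (Icc I y y))) => x; split.
    by case=> [[]//|[? ?]]; have -> : x = y by ord.
  by move=> Ax; have [->|ne] := pselect (x = y); [right; split|left].
by apply: fci_ext fB => x; split=> [[]//|Ax]; split=> // e; apply: Ay; rewrite -e.
Qed.

Lemma fci_inter A B : fci A -> fci B -> fci (s_inter I A B).
Proof.
have lub i i' : exists m, forall t, le m t <-> le i t /\ le i' t.
  case: (le_total i i') => h; [exists i'|exists i] => t;
    by split=> [?|[]//]; split; ord.
have glb j j' : exists m, forall t, le t m <-> le t j /\ le t j'.
  case: (le_total j j') => h; [exists j|exists j'] => t;
    by split=> [?|[]//]; split; ord.
have cc c c' : fci (s_inter I (cints c) (cints c')).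
  have cl d : (forall t, cints d t <-> cints c t /\ cints c' t) ->
      fci (s_inter I (cints c) (cints c')).
    by move=> h; apply: fci_ext (fci_cint d).
  case: c c' cl => [i j|i|j] [i' j'|i'|j'] /= cl.
  - have [m hm] := lub i i'; have [m' hm'] := glb j j'.
    by apply: (cl (Icc I m m')) => t /=; rewrite hm hm'; tauto.
  - by have [m hm] := lub i i'; apply: (cl (Icc I m j)) => t /=; rewrite hm; tauto.
  - by have [m hm] := glb j j'; apply: (cl (Icc I i m)) => t /=; rewrite hm; tauto.
  - by have [m hm] := lub i i'; apply: (cl (Icc I m j')) => t /=; rewrite hm; tauto.
  - by have [m hm] := lub i i'; apply: (cl (Ici I m)) => t /=; rewrite hm; tauto.
  - by apply: (cl (Icc I i j')).
  - by have [m hm] := glb j j'; apply: (cl (Icc I i' m)) => t /=; rewrite hm; tauto.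
  - by apply: (cl (Icc I i' j)) => t /=; tauto.
  - by have [m hm] := glb j j'; apply: (cl (Iic I m)) => t /=; rewrite hm.
have cB c l : fci (s_inter I (cints c) (fun t => covers l t)).
  elim: l => [|c' l IH]; first by apply: fci_ext fci_bot => x; split=> // -[_ [? []]].
  apply: fci_ext (fci_union (cc c c') IH) => x; split.
    case=> -[cx]; first by split=> //; exists c'; split=> //; left.
    by case=> d [dl dx]; split=> //; exists d; split=> //; right.
  by case=> cx [d [[<-|dl] dx]]; [left|right; split=> //; exists d].
case=> l Hl [l' Hl'].
apply: (@fci_ext (s_inter I (fun t => covers l t) (fun t => covers l' t))).
  by move=> x; rewrite /s_inter Hl Hl'.
elim: l {A Hl} => [|c l IH]; first by apply: fci_ext fci_bot => x; split=> // -[[? []]].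
apply: fci_ext (fci_union (cB c l') IH) => x; split.
  case=> -[]; first by move=> cx; split=> //; exists c; split=> //; left.
  by case=> d [dl dx] h; split=> //; exists d; split=> //; right.
by case=> -[d [[<-|dl] dx]] h; [left|right; split=> //; exists d].
Qed.

Lemma list_extremum (R : I -> I -> Prop) (Q : I -> Prop) (E : seq I) :
  (forall x y, R x y \/ R y x) -> (forall x y w, R x y -> R y w -> R x w) ->
  (exists2 d, List.In d E & Q d) ->
  exists2 m, Q m & forall d, List.In d E -> Q d -> R d m.
Proof.
move=> tot tr; have rfl x : R x x by case: (tot x x).
elim: E => [[e []]|d E IH].
have [/IH[m Qm Hm] _|nE] := pselect (exists2 d, List.In d E & Q d); last first.
  case=> e [->|eE] Qe; last by case: nE; exists e.
  exists e => // e' [->//|e'E] Qe'; by case: nE; exists e'.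
have [Qd|nQd] := pselect (Q d); last first.
  by exists m => // e [<-|/Hm].
case: (tot d m) => h; first by exists m => // e [<-|/Hm].
by exists d => // e [<-//|eE] Qe; apply: tr h; apply: Hm.
Qed.

(** The right end of the component of [x] is sought among [x] and the right ends of the intervals
    presenting [A]: it is the greatest such [y] with the segment from [x] to [y] inside [A]. *)
Lemma component_right A x : fci A -> A x ->
  (forall t, le x t -> A t) \/
  exists y, [/\ le x y, forall t, le x t -> le t y -> A t &
    forall u, y ≺ u -> ~ forall t, le x t -> le t u -> A t].
Proof.
case=> l Al Ax; have [|nA] := pselect (forall t, le x t -> A t); first by left.
(* The value at [Ici] is a dummy: it is used only for an interval that contains [u] but not the
   larger point [t], hence not for an unbounded one. *)
right; pose right_end (c : cint I) := match c with Icc _ j | Iic j | Ici j => j end.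
pose Q y := le x y /\ forall t, le x t -> le t y -> A t.
have Qx : Q x by split=> // t ? ?; have -> : t = x by ord.
have [|m [xm Am] Hm] := @list_extremum le Q (x :: map right_end l) le_total le_trans.
  by exists x => //; left.
exists m; split=> // u mu H; apply: nA => t xt.
have [tu|ut] := pselect (le t u); first exact: H.
have [c [cl cu]] : covers l u by apply/Al; apply: H; ord.
have [ct|nct] := pselect (cints c t); first by apply/Al; exists c.
suff [le1 /Hm le2] : le u (right_end c) /\ Q (right_end c).
  have : le (right_end c) m; last by move=> ?; exfalso; ord.
  by apply: le2; right; apply: List.in_map.
have sub : forall w, le u w -> le w (right_end c) -> cints c w.
  by case: c cl cu nct => [i j|i|j] //= _ => [[? ?] _|? nct] w ? ?; [split; ord|ord].
have le1 : le u (right_end c).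
  case: c cl cu nct {sub} => [i j|i|j] //= _; first by case.
  by move=> iu it; exfalso; apply: it; ord.
split=> //; split; first by ord.
move=> w xw wr; have [wu|uw] := pselect (le w u); first exact: H.
by apply/Al; exists c; split=> //; apply: sub => //; ord.
Qed.

Lemma component_left A x : fci A -> A x ->
  exists y, [/\ le y x, forall t, le y t -> le t x -> A t &
    forall u, u ≺ y -> ~ forall t, le u t -> le t x -> A t].
Proof.
case=> l Al Ax; pose left_end (c : cint I) := match c with Icc i _ | Ici i => i | Iic _ => z end.
pose Q y := le y x /\ forall t, le y t -> le t x -> A t.
have Qx : Q x by split=> // t ? ?; have -> : t = x by ord.
have [|||m [xm Am] Hm] := @list_extremum (fun a b => le b a) Q (x :: map left_end l).
- by move=> a b; case: (le_total a b); [right|left].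
- by move=> a b c ? ?; ord.
- by exists x => //; left.
exists m; split=> // u um H.
have [c [cl cu]] : covers l u by apply/Al; apply: H; ord.
have cl1 : le (left_end c) u by case: c cl cu => [i j|i|j] //= _ [].
have : le m (left_end c); last by move=> ?; ord.
apply: Hm; first by right; apply: List.in_map.
split; first by ord.
move=> w xw wr; have [wu|uw] := pselect (le u w); first exact: H.
apply/Al; exists c; split=> //.
by case: c cl cu cl1 xw => [i j|i|j] //= _; [case=> *; split; ord|move=> *; ord].
Qed.

(** This trades maximal intervals for a first-order condition on points, as [def_eval] requires. If
    [A] contained a segment ending at [x] from the left, its union with the interval starting at [x]
    would be a larger closed interval inside [A]. Conversely [component_right] supplies a maximal
    interval starting at [x]. *)
Lemma s_lP A x : fci A ->
  s_l I le A x <-> A x /\ forall y, y ≺ x -> ~ forall t, le y t -> le t x -> A t.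
Proof.
move=> fA; split.
  case=> J [[[c Jc] [_ [JA Jmax]]] [Jx xmin]]; split; first exact: JA.
  move=> y yx yA; have cx : cints c x by apply/Jc.
  have cmin t : cints c t -> le x t by move/Jc; apply: xmin.
  have [c' c'E] : exists c', forall t,
      cints c' t <-> (le y t /\ le t x) \/ cints c t.
    case: c {Jc} cx cmin => [i j|i|j] /= cx cmin.
    - have xi : le x i by apply: cmin; split; ord.
      exists (Icc I y j) => t /=; split=> [[yt tj]|[[yt tx]|[it tj]]].
      + have [tx|xt] := pselect (le t x); first by left.
        by right; split; ord.
      + by split=> //; ord.
      + by split=> //; ord.
    - have xi : le x i by apply: cmin.
      exists (Ici I y) => t /=; split=> [yt|[[yt tx]//|it]]; last by ord.
      by have [tx|xt] := pselect (le t x); [left|right; ord].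
    - by have := cmin z (ge_z j); have := ge_z y; move=> ? ?; exfalso; ord.
  have /xmin : J y; last by [].
  apply: (Jmax (cints c')); first by exists c'.
  - by move=> t /Jc ct; apply/c'E; right.
  - by move=> t /c'E[[? ?]|/Jc/JA//]; apply: yA.
  - by apply/c'E; left; split; [apply: le_refl|ord].
case=> Ax H; have xmin J : is_closed_interval I le J -> J x -> subset I J A ->
    forall t, J t -> le x t.
  case=> c Jc Jx JA t Jt; apply: le_nn => tx; apply: (H t tx) => w tw wx.
  apply: JA; apply/Jc; move/Jc: Jx; move/Jc: Jt.
  by case: c {Jc} => [i j|i|j] /= => [[? ?] [? ?]|? ?|? ?]; [split| |]; ord.
case: (component_right fA Ax) => [allA|[y [xy yA ymax]]].
- exists (fun t => le x t); split; last by split.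
  split; first by exists (Ici I x).
  split; first by exists x.
  split; first by move=> t /allA.
  by move=> J' cJ' sJ' J'A t; apply: (xmin J') => //; apply: sJ'.
- exists (fun t => le x t /\ le t y); split; last by split=> // t [].
  split; first by exists (Icc I x y).
  split; first by exists x.
  split; first by move=> t [? ?]; apply: yA.
  move=> J' cJ' sJ' J'A t J't.
  have J'x : J' x by apply: sJ'.
  have xt := xmin J' cJ' J'x J'A t J't; split=> //.
  apply: le_nn => yt; apply: (ymax t yt) => w xw wt; apply: J'A.
  case: cJ' => c J'c; apply/J'c; move/J'c: J'x; move/J'c: J't.
  by case: c {J'c} => [i j|i|j] /= => [[? ?] [? ?]|? ?|? ?]; [split| |]; ord.
Qed.

Lemma s_rP A x : fci A ->
  s_r I le A x <-> A x /\ forall y, x ≺ y -> ~ forall t, le x t -> le t y -> A t.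
Proof.
move=> fA; split.
  case=> J [[[c Jc] [_ [JA Jmax]]] [Jx xmax]]; split; first exact: JA.
  move=> y xy yA; have cx : cints c x by apply/Jc.
  have cmax t : cints c t -> le t x by move/Jc; apply: xmax.
  have [c' c'E] : exists c', forall t,
      cints c' t <-> (le x t /\ le t y) \/ cints c t.
    case: c {Jc} cx cmax => [i j|i|j] /= cx cmax.
    - have jx : le j x by apply: cmax; split; ord.
      exists (Icc I i y) => t /=; split=> [[yt tj]|[[yt tx]|[it tj]]].
      + have [tx|xt] := pselect (le x t); first by left.
        by right; split; ord.
      + by split=> //; ord.
      + by split=> //; ord.
    - by have := cmax y; move=> h; exfalso; apply: (xy); apply: h; ord.
    - have jx : le j x by apply: cmax.
      exists (Iic I y) => t /=; split=> [ty|[[xt ty]//|tj]]; last by ord.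
      by have [tx|xt] := pselect (le x t); [left|right; ord].
  have /xmax : J y; last by [].
  apply: (Jmax (cints c')); first by exists c'.
  - by move=> t /Jc ct; apply/c'E; right.
  - by move=> t /c'E[[? ?]|/Jc/JA//]; apply: yA.
  - by apply/c'E; left; split; [ord|apply: le_refl].
case=> Ax H; have [y [yx yA ymin]] := component_left fA Ax.
exists (fun t => le y t /\ le t x); split; last by split=> // t [].
split; first by exists (Icc I y x).
split; first by exists x.
split; first by move=> t [? ?]; apply: yA.
move=> J' [c J'c] sJ' J'A t J't.
have J'x : J' x by apply: sJ'.
have conv u w : J' u -> J' w -> forall v, le u v -> le v w -> J' v.
  move=> /J'c cu /J'c cw v uv vw; apply/J'c.
  by case: c {J'c} cu cw => [i j|i|j] /=; [case=> ? ? [? ?]; split|move=> ? ?|move=> ? ?]; ord.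
split; apply: le_nn => h.
  by apply: (ymin t h) => w tw wx; apply: J'A; apply: (conv t x).
by apply: (H t h) => w xw wt; apply: J'A; apply: (conv x t).
Qed.

(** The endpoint criteria [s_lP] and [s_rP] can be applied to subterms because values stay in the
    universe. For [l] and [r] the value is finite, each endpoint being an end of some interval that
    presents the argument. *)
Lemma fci_eval rho (t : term) : (forall n, fci (rho n)) -> fci (eval I le z rho t).
Proof.
move=> fr; have fsub A : (forall x y, A x -> A y -> x = y) -> fci A.
  move=> sub; have [[x Ax]|nA] := pselect (exists x, A x).
    by apply: (@fci_finite A [:: x]) => y Ay; left; apply: sub.
  by apply: (@fci_finite A [::]) => y Ay; apply: nA; exists y.
elim: t => [n|t1 f1 t2 f2|t1 f1 t2 f2|||t f|t f|t f|t f] /=.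
- exact: fr.
- exact: fci_union.
- exact: fci_inter.
- exact: fci_bot.
- by apply: fsub => x y -> ->.
- by apply: fsub => x y [Ax hx] [Ay hy]; apply: le_anti; [apply: hx|apply: hy].
- by apply: fsub => x y [Ax hx] [Ay hy]; apply: le_anti; [apply: hy|apply: hx].
- have [l Hl] := f.
  apply: (@fci_finite _ (map (fun c => match c with Icc i _ | Ici i => i | Iic _ => z end) l)).
  move=> x /(s_lP _ f)[/Hl[c [cl cx]] H].
  suff -> : x = match c with Icc i _ | Ici i => i | Iic _ => z end.
    by apply: (List.in_map _ _ _ cl).
  apply: le_anti; last by case: c cx {cl} => [i j|i|j] //= [].
  apply: le_nn => h; apply: (H _ h) => w h1 h2; apply/Hl; exists c; split=> //.
  by case: c cx h h1 {cl} => [i j|i|j] /=; [case=> *; split; ord|move=> *; ord|move=> *; ord].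
- have [l Hl] := f.
  (* The value at [Ici] is a dummy, since no right endpoint lies in an unbounded interval contained
     in the set. *)
  apply: (@fci_finite _ (map (fun c => match c with Icc _ j | Ici j | Iic j => j end) l)).
  move=> x /(s_rP _ f)[/Hl[c [cl cx]] H].
  suff -> : x = match c with Icc _ j | Ici j | Iic j => j end.
    by apply: (List.in_map _ _ _ cl).
  have [y xy] := no_max x.
  have up u : (forall w, le x w -> le w u -> cints c w) -> le u x.
    move=> h; apply: le_nn => xu; apply: (H u xu) => w h1 h2.
    by apply/Hl; exists c; split=> //; apply: h.
  case: c cx up {cl} => [i j|i|j] /= => [[ix xj]|ix|xj] up; apply: le_anti => //.
  + by apply: up => w ? ?; split; ord.
  + by exfalso; apply: (xy); apply: up => w ? ?; ord.
  + by apply: up => w ? ?; ord.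
Qed.

(** The index [i] stays general in the induction: extrema and endpoints evaluate the subterm at the
    auxiliary elements [i.+1] and [i.+2], which leave [e i] untouched. *)
Lemma def_eval (t : term) i : definable (fun rho e => eval I le z rho t (e i)).
Proof.
have upN e j k x : k != j -> upd_point e j x k = e k.
  by rewrite /upd_point => /negbTE->.
have upE e j x : upd_point e j x j = x by rewrite /upd_point eqxx.
have neS k : k != k.+1 by rewrite neq_ltn ltnSn.
have neSS k : k != k.+2 by rewrite neq_ltn ltnW.
elim: t i => [n|t1 d1 t2 d2|t1 d1 t2 d2|||t d|t d|t d|t d] i /=.
- exact: def_mem.
- exact: def_or.
- exact: def_and.
- apply: def_ext (def_lt 0 0) => rho e _; split=> // h; ord.
- apply: def_ext (def_not (def_exists_point i.+1 (def_lt i.+1 i))) => rho e _.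
  rewrite /s_c0; split=> [H|e0 [x]]; last by rewrite upE upN // e0; apply.
  apply: le_anti => //; apply: le_nn => h; apply: H; exists z.
  by rewrite upE upN.
- apply: def_ext (def_and (d i)
    (def_not (def_exists_point i.+1 (def_and (d i.+1) (def_lt i.+1 i))))).
  move=> rho e _; split=> -[Ai H]; split=> //.
    move=> y Ay; apply: le_nn => h; apply: H; exists y.
    by rewrite upE upN.
  by case=> y; rewrite upE upN // => -[/H ? ?]; ord.
- apply: def_ext (def_and (d i)
    (def_not (def_exists_point i.+1 (def_and (d i.+1) (def_lt i i.+1))))).
  move=> rho e _; split=> -[Ai H]; split=> //.
    move=> y Ay; apply: le_nn => h; apply: H; exists y.
    by rewrite upE upN.
  by case=> y; rewrite upE upN // => -[/H ? ?]; ord.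
- apply: def_ext (def_and (d i) (def_not (def_exists_point i.+1
    (def_and (def_lt i.+1 i) (def_not (def_exists_point i.+2
    (def_and (def_not (def_lt i.+2 i.+1)) (def_and (def_not (def_lt i i.+2))
    (def_not (d i.+2)))))))))) => rho e fr.
  rewrite s_lP; last exact: fci_eval.
  split=> -[Ai H]; split=> //.
    move=> y yi yA; apply: H; exists y; rewrite upE !upN //; split=> // -[w].
    rewrite upE (upN _ _ i.+1) // upE !upN // => -[/le_nn ? [/le_nn ? ]].
    by apply; apply: yA.
  case=> y; rewrite upE upN // => -[yi H']; apply: (H y yi) => w yw wi.
  apply: contrapT => nA; apply: H'; exists w.
  by rewrite upE (upN _ _ i.+1) // upE !upN //; split; [|split]; [move=> h; ord|move=> h; ord|].
- apply: def_ext (def_and (d i) (def_not (def_exists_point i.+1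
    (def_and (def_lt i i.+1) (def_not (def_exists_point i.+2
    (def_and (def_not (def_lt i.+2 i)) (def_and (def_not (def_lt i.+1 i.+2))
    (def_not (d i.+2)))))))))) => rho e fr.
  rewrite s_rP; last exact: fci_eval.
  split=> -[Ai H]; split=> //.
    move=> y yi yA; apply: H; exists y; rewrite upE !upN //; split=> // -[w].
    rewrite upE (upN _ _ i.+1) // upE !upN // => -[/le_nn ? [/le_nn ? ]].
    by apply; apply: yA.
  case=> y; rewrite upE upN // => -[yi H']; apply: (H y yi) => w yw wi.
  apply: contrapT => nA; apply: H'; exists w.
  by rewrite upE (upN _ _ i.+1) // upE !upN //; split; [|split]; [move=> h; ord|move=> h; ord|].
Qed.

Lemma def_sat f : definable (fun rho _ => sat I le z rho f).
Proof.
elim: f => [t1 t2||f d|f d g d'|f d g d'|f d g d'|n f d|n f d] /=.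
- have d1 := def_eval t1 0; have d2 := def_eval t2 0.
  apply: def_ext (def_not (def_exists_point 0 (def_not
    (def_and (def_imp d1 d2) (def_imp d2 d1))))) => rho e _.
  split=> [H x|H [x]]; last by apply; split=> /H.
  by apply: contrapT => h; apply: H; exists x => -[h1 h2]; apply: h.
- by apply: def_ext (def_lt 0 0) => rho e _; split=> // h; ord.
- exact: def_not.
- exact: def_and.
- exact: def_or.
- exact: def_imp.
- exact: (def_exists_set n d).
- apply: def_ext (def_not (def_exists_set n (def_not d))) => rho e _.
  split=> [H A fA|H [A [fA]]]; last by apply; apply: H.
  by apply: contrapT => h; apply: H; exists A.
Qed.

(** * Runs coded by sets *)

Section Certificate.

Variables (V : eqType) (D : dfa V).
Implicit Types (al : V -> I -> Prop).

Local Notation vs := (support D).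
Local Notation vals := ((size vs).-tuple bool).

(** Restricting letters to the support and storing them as tuples makes [label] a finite type, so
    that finitely many set variables can be indexed by it. *)
Definition vals_of (f : V -> bool) : vals := map_tuple f (in_tuple vs).

Definition fun_of_vals (a : vals) : V -> bool := fun v => nth false a (index v vs).

Lemma vals_ofK f v : v \in vs -> fun_of_vals (vals_of f) v = f v.
Proof.
by move=> hv; rewrite /fun_of_vals /= (nth_map v) ?index_mem // nth_index.
Qed.

(* A transition of the run: source state, letter, and the parity of its
   position, which keeps apart adjacent intervals with equal transitions. *)
Definition label : finType := (state D * (vals * vals) * bool)%type.

Implicit Types (mu : label) (X : label -> I -> Prop).

Definition source mu : state D := mu.1.1.
Definition point_val mu : V -> bool := fun_of_vals mu.1.2.1.
Definition gap_val mu : V -> bool := fun_of_vals mu.1.2.2.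
Definition target mu : state D := trans (source mu) (point_val mu, gap_val mu).

Local Notation left := (s_l I le).
Local Notation right := (s_r I le).

(** Every clause is local to a component or a junction. [cert_nondeg] excludes one-point components,
    [cert_point] tests a cut only where an interval starts, and [cert_gap] allows for the ends when
    the gap value is false. By [cert_final] an unbounded component occurs only in some [X mu] with
    final target. *)
Record certificate X al : Prop := Certificate {
  cert_init : exists mu, source mu = init D /\ left (X mu) z;
  cert_nondeg : forall mu x, left (X mu) x -> ~ right (X mu) x;
  cert_step : forall mu x, right (X mu) x ->
    exists mu', source mu' = target mu /\ left (X mu') x;
  cert_point : forall mu v x, v \in vs -> left (X mu) x ->
    if point_val mu v then al v x else ~ al v x;
  cert_gap : forall mu v x, v \in vs -> X mu x ->
    if gap_val mu v then al v x
    else al v x -> left (X mu) x \/ right (X mu) x;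
  cert_final : forall mu, ~~ final (target mu) ->
    (exists x, X mu x) -> exists x, s_max I le (X mu) x }.

(* One cut point [x] inside an interval of [X mu]: either the interval starts at
   [x] and the automaton makes its transition there, or [x] is an interior
   point, where the automaton stutters. *)
Lemma certificate_local X al x s mu q : fci (X mu) -> certificate X al ->
  compat vs al x s -> gap_const (X mu) x s -> X mu x -> ~ right (X mu) x ->
  (left (X mu) x /\ q = source mu) \/ (~ left (X mu) x /\ q = target mu) ->
  (forall t, x ≺ t -> below t s -> X mu t) /\
  trans q (letter_at al x) = target mu.
Proof.
move=> fX [_ _ _ c_point c_gap _] c cX Xx nr hq.
have gX : right_germ (X mu) x.
  apply: contrapT => ng; apply: nr; apply/s_rP => //; split=> // u xu H.
  apply: ng; apply: (right_germ_eq xu) => t xt tu.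
  by apply/asboolP; apply: H; ord.
have inX t : x ≺ t -> below t s -> X mu t.
  move=> xt ts; have [_ h _] := gap_const_insert cX xt ts.
  by apply/asboolP; rewrite h.
have inX' t u : le x t -> le t u -> below u s -> X mu t.
  move=> xt tu us; case: (le_below_cases s xt) => [->//|[xt' ts]|[y [r [e yt]]]].
    exact: inX.
  by move: us; rewrite e /= => uy; exfalso; ord.
have inner v t : v \in vs -> X mu t -> ~ left (X mu) t -> ~ right (X mu) t ->
    `[< al v t >] = gap_val mu v.
  move=> hv Xt nl nr'; move: (c_gap mu v t hv Xt).
  by case: ifP => _ h; [exact: asboolT|apply: asboolF => /h[]].
have germ v : v \in vs -> right_germ (al v) x = gap_val mu v.
  move=> hv; have [t xt ts] := exists_below c.1.
  rewrite -(letter_at_gap c xt ts hv); apply: inner => //; first exact: inX.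
    move/(s_lP _ fX) => [_ /(_ x xt)]; apply => u xu ut.
    exact: (inX' u t).
  have [u tu us] := exists_below (compat_tail (compat_insert c xt ts).1).1.
  move/(s_rP _ fX) => [_ /(_ u tu)]; apply => w tw wu.
  by apply: (inX' w u) => //; ord.
split=> //; case: hq => -[lx ->].
  apply: trans_agree; split=> v hv /=; last exact: germ.
  move: (c_point mu v x hv lx); case: ifP => _ ?; [exact: asboolT|exact: asboolF].
rewrite -[RHS](trans_stutter (source mu)); apply: trans_agree.
by split=> v hv /=; [apply: inner|apply: germ].
Qed.

(** A chain of components is followed along cuts that suit the [X mu] as well. At each cut the state
    is the source of the current label if its interval starts there, and its target if the cut is
    interior. After the last cut the current component is unbounded, so its target is final. *)
Lemma certificate_sound X al s : (forall mu, fci (X mu)) -> certificate X al ->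
  compat vs al z s -> (forall mu, gap_const (X mu) z s) ->
  final (run (init D) (word al z s)).
Proof.
move=> fX cert c cX; have [mu [si lz]] := cert_init cert.
have Xz : X mu z by case/(s_lP _ (fX mu)): lz.
have: (left (X mu) z /\ init D = source mu) \/
  (~ left (X mu) z /\ init D = target mu) by left.
have {lz si} := cert_nondeg cert lz.
elim: s (z) (init D) mu c cX Xz => [|y r IH] x q mu c cX Xx nr hq.
  have [inX tE] := certificate_local (fX mu) cert c (cX mu) Xx nr hq.
  rewrite /run /= tE; apply: contrapT => /negP nf.
  have [m [Xm maxm]] := cert_final cert nf (ex_intro _ x Xx).
  have [t mt] := no_max m; apply: (mt); apply: (maxm).
  by apply: inX => //; have := maxm x Xx => ?; ord.
have [inX tE] := certificate_local (fX mu) cert c (cX mu) Xx nr hq.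
have xy : x ≺ y by case: c => [[]].
have Xy : X mu y by case: (fci_closed (fX mu) xy).
have nl : ~ left (X mu) y.
  move/(s_lP _ (fX mu)) => [_ /(_ x xy)]; apply => t xt ty.
  have [->|ne] := pselect (t = y) => //.
  have [->|ne'] := pselect (t = x) => //.
  by apply: inX => [h|/= h]; [apply: ne'|apply: ne]; ord.
rewrite -[word _ _ _]/(letter_at al x :: word al y r) [run _ _]/= tE.
have cX' mu' : gap_const (X mu') y r by case: (cX mu').
have [ry|nry] := pselect (right (X mu) y).
  have [mu' [sE ly]] := cert_step cert ry.
  apply: (IH y (target mu) mu') => //; first exact: compat_tail c.
  - by case/(s_lP _ (fX mu')): ly.
  - exact: (cert_nondeg cert ly).
  - by left.
by apply: (IH y (target mu) mu) => //; [exact: compat_tail c|right].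
Qed.

(** * Labelled closed gaps of an accepting run *)

Fixpoint pieces al x s q k : seq (label * cint I) :=
  let: mu := (q, (vals_of (letter_at al x).1, vals_of (letter_at al x).2), k) in
  match s with
  | [::] => [:: (mu, Ici I x)]
  | y :: s' => (mu, Icc I x y) :: pieces al y s' (trans q (letter_at al x)) (~~ k)
  end.

Definition left_end (c : cint I) : I :=
  match c with Icc i _ | Ici i => i | Iic _ => z end.

Definition inside (c : cint I) t : Prop :=
  match c with
  | Icc i j => i ≺ t /\ t ≺ j
  | Ici i => i ≺ t
  | Iic j => t ≺ j
  end.

Lemma piece_target al x q k :
  target (q, (vals_of (letter_at al x).1, vals_of (letter_at al x).2), k) =
  trans q (letter_at al x).
Proof. by apply: trans_agree; split=> v hv; apply: vals_ofK. Qed.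

Lemma pieces_head al x s q k : exists mu c,
  [/\ List.In (mu, c) (pieces al x s q k), left_end c = x, source mu = q & mu.2 = k].
Proof.
by case: s => [|y s] /=; eexists _, _; split; [left| | | |left| | |].
Qed.

Lemma piecesP al x s q k mu c : compat vs al x s ->
  List.In (mu, c) (pieces al x s q k) ->
  [/\ le x (left_end c),
      (exists2 y, c = Icc I (left_end c) y & left_end c ≺ y) \/
        c = Ici I (left_end c),
      forall v, v \in vs -> `[< al v (left_end c) >] = point_val mu v &
      forall v t, v \in vs -> inside c t -> `[< al v t >] = gap_val mu v].
Proof.
elim: s x q k => [|y s IH] x q k cp /=.
  case=> // -[<- <-]; split=> //=; first by right.
    by move=> v hv; rewrite /point_val vals_ofK.
  by move=> v t hv xt; rewrite /gap_val vals_ofK //; apply: letter_at_gap cp _ _ hv.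
case=> [[<- <-]|/(IH _ _ _ (compat_tail cp))[h1 h2 h3 h4]].
  split=> //=; first by left; exists y => //; case: cp => [[]].
    by move=> v hv; rewrite /point_val vals_ofK.
  move=> v t hv [xt ty]; rewrite /gap_val vals_ofK //.
  exact: letter_at_gap cp _ _ hv.
by split=> //; case: cp => [[xy _] _]; ord.
Qed.

Lemma pieces_next al x s q k mu u w :
  List.In (mu, Icc I u w) (pieces al x s q k) -> exists mu' c',
    [/\ List.In (mu', c') (pieces al x s q k), left_end c' = w,
        source mu' = target mu & mu'.2 = ~~ mu.2].
Proof.
elim: s x q k => [|y s IH] x q k /=; first by case.
case=> [[<- _ <-]|/IH[mu' [c' [h1 h2 h3 h4]]]]; last first.
  by exists mu', c'; split=> //; right.
have [mu' [c' [h1 h2 h3 h4]]] := pieces_head al y s (trans q (letter_at al x)) (~~ k).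
by exists mu', c'; split=> //; [right|rewrite piece_target].
Qed.

Lemma pieces_prev al x s q k mu c :
  List.In (mu, c) (pieces al x s q k) ->
  (left_end c = x /\ mu.2 = k) \/ exists mu' u,
    List.In (mu', Icc I u (left_end c)) (pieces al x s q k) /\ mu'.2 = ~~ mu.2.
Proof.
elim: s x q k => [|y s IH] x q k /=; first by case=> // -[<- <-]; left.
case=> [[<- <-]|/IH[[-> ->]|[mu' [u [h1 h2]]]]]; first by left.
  by right; eexists _, x; split; [left|rewrite negbK].
by right; exists mu', u; split=> //; right.
Qed.

(** One of the two memberships must be interior, because neighbouring closed gaps share a cut. This
    is how a component is shown not to extend beyond its gap: an extension would contain an interior
    point of the neighbouring gap, whose label has the other parity. *)
Lemma pieces_disjoint al x s q k mu mu' c c' t : compat vs al x s ->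
  List.In (mu, c) (pieces al x s q k) -> List.In (mu', c') (pieces al x s q k) ->
  inside c t -> cints c' t -> mu = mu'.
Proof.
elim: s x q k => [|y s IH] x q k cp /=; first by case=> // -[<- _] [] // [<- _].
have xy : x ≺ y by case: cp => [[]].
have ge (nu : label) d u : List.In (nu, d) (pieces al y s (trans q (letter_at al x)) (~~ k)) ->
    cints d u -> le y u.
  case/(piecesP (compat_tail cp)) => h [[w -> _]|->] _ _ /= => [[? ?]|?]; ord.
have ins d u : inside d u -> cints d u by case: d => [i j|i|j] /= => [[? ?]|?|?]; [split| |]; ord.
case=> [[<- <-]|h] [[<- <-]|h'] //.
- by move=> [_ ty] /(ge _ _ _ h') ?; exfalso; ord.
- have : forall u, inside c u -> y ≺ u; last first.
    by move=> lt /lt ? [_ ?]; exfalso; ord.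
  case/(piecesP (compat_tail cp)): h => g [[w -> _]|->] _ _ u /= => [[? ?]|?]; ord.
- exact: IH (compat_tail cp) h h'.
Qed.

Lemma pieces_last al x s q k mu u : List.In (mu, Ici I u) (pieces al x s q k) ->
  target mu = run q (word al x s).
Proof.
elim: s x q k => [|y s IH] x q k /=; last by case=> [//|/IH].
by case=> // -[<- _]; apply: piece_target.
Qed.

Lemma fci_pieces (ps : seq (label * cint I)) mu :
  fci (fun t => exists2 c, List.In (mu, c) ps & cints c t).
Proof.
exists (flatten (map (fun p : label * cint I =>
  if p.1 == mu then [:: p.2] else [::]) ps)) => t.
elim: ps => [|[nu d] ps IH] /=; first by split=> [[c []]|[c []]].
split=> [[c [[-> ->]|h]] ct|[c [/(List.in_app_or _ _ _)[] h ct]]].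
- by exists c; split=> //; rewrite eqxx; left.
- have [c' [h' c't]] : covers (flatten [seq (if p.1 == mu then [:: p.2] else [::])
     | p : label * cint I <- ps]) t by apply/IH; exists c.
  by exists c'; split=> //; apply/List.in_or_app; right.
- by move: h; case: eqVneq => [->|_] //= [->|//]; exists c => //; left.
- by have [c' ? ?] := (IH.2 (ex_intro _ c (conj h ct))); exists c' => //; right.
Qed.

Lemma certificate_complete al s : (forall v, fci (al v)) -> compat vs al z s ->
  final (run (init D) (word al z s)) ->
  exists X, (forall mu, fci (X mu)) /\ certificate X al.
Proof.
move=> fal cp fin; pose ps := pieces al z s (init D) false.
pose X mu t := exists2 c, List.In (mu, c) ps & cints c t.
have psP mu c := @piecesP al z s (init D) false mu c cp.
have fX mu : fci (X mu) by exact: fci_pieces.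
have XI mu c t : List.In (mu, c) ps -> cints c t -> X mu t by exists c.
have ins c t : inside c t -> cints c t.
  by case: c => [i j|i|j] /= => [[? ?]|?|?]; [split| |]; ord.
have l_end mu c : List.In (mu, c) ps -> cints c (left_end c).
  by case/psP => _ [[y -> ?]|->] _ _ /=; [split; ord|ord].
have leftP mu t : left (X mu) t -> exists2 c, List.In (mu, c) ps & t = left_end c.
  case/(s_lP _ (fX mu)) => -[c h ct] H; exists c => //.
  have := psP mu c h => -[_ sh _ _].
  have [//|ne] := pselect (t = left_end c).
  have lt : left_end c ≺ t.
    by case: sh ct => [[y -> _]|->] /= => [[? ?]|?] ?; apply: ne; ord.
  exfalso; apply: (H _ lt) => w lw wt; apply: XI h _.
  by case: sh ct lw => [[y -> _]|->] /=; [case=> ? ? ?; split; ord|].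
have left_endP mu c : List.In (mu, c) ps -> left (X mu) (left_end c).
  move=> h; apply/s_lP => //; split; first exact: XI h (l_end _ _ h).
  move=> y yl yX; case: (pieces_prev h) => [[e _]|[mu' [u [h' par]]]].
    by rewrite e in yl; have := ge_z y => ?; ord.
  have [_ [[w /= [<-] uw]|//] _ _] := psP _ _ h'.
  (* A point both in the supposed extension to the left and in the interior of the preceding gap. *)
  have [t [yt ut tl]] := dense2 yl uw.
  have [c' h'' c't] : X mu t by apply: yX; ord.
  have e : mu' = mu by apply: (pieces_disjoint cp h' h'' _ c't).
  by move: par; rewrite e; case: (mu.2).
have rightP mu t : right (X mu) t -> exists u, List.In (mu, Icc I u t) ps.
  case/(s_rP _ (fX mu)) => -[c h ct] H.
  have := psP mu c h => -[_ sh _ _].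
  case: sh h ct => [[y -> _]|->] h /= => [[lt ty]|lt].
    have [->|ne] := pselect (t = y); first by exists (left_end c).
    have {}ty' : t ≺ y by move=> ?; apply: ne; ord.
    exfalso; apply: (H _ ty') => w tw wy; apply: XI h _; split; ord.
  have [y ty] := no_max t; exfalso; apply: (H _ ty) => w tw wy.
  by apply: XI h _ => /=; ord.
have right_endP mu u w : List.In (mu, Icc I u w) ps -> right (X mu) w.
  move=> h; have [_ [[w' /= [<-] uw]|//] _ _] := psP _ _ h.
  apply/s_rP => //; split; first by apply: XI h _; split; ord.
  move=> y wy yX; have [mu' [c' [h' le' _ par]]] := pieces_next h.
  have [t [wt ty it]] : exists t, [/\ w ≺ t, t ≺ y & inside c' t].
    have [_ sh _ _] := psP _ _ h'; rewrite le' in sh.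
    case: sh => [[y' -> wy']|->] /=.
      by have [t [? ? ?]] := dense2r wy wy'; exists t.
    by have [t ? ?] := dense wy; exists t.
  have [c'' h'' c''t] : X mu t by apply: yX; ord.
  have e : mu' = mu by apply: (pieces_disjoint cp h' h'' it c''t).
  by move: par; rewrite e; case: (mu.2).
exists X; split=> //; split.
- have [mu [c [h e1 e2 _]]] := pieces_head al z s (init D) false.
  by exists mu; split=> //; rewrite -e1; apply: left_endP.
- move=> mu x /leftP[c h ->] /(s_rP _ (fX mu)) [_ H].
  have [_ [[y e ly]|e] _ _] := psP _ _ h.
    by apply: (H y ly) => t lt ty; apply: XI h _; rewrite e; split.
  have [y ly] := no_max (left_end c).
  by apply: (H y ly) => t lt ty; apply: XI h _; rewrite e.
- move=> mu x /rightP[u /pieces_next[mu' [c' [h e se _]]]].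
  by exists mu'; split=> //; rewrite -e; apply: left_endP.
- move=> mu v x hv /leftP[c h ->]; have [_ _ pv _] := psP _ _ h.
  by rewrite -(pv v hv); case: asboolP.
- move=> mu v x hv [c h cx]; have [_ sh _ gv] := psP _ _ h.
  case: ifP => g.
    (* A set true on the open gap contains its ends because [al v] is closed; here the hypothesis
       [fal] is essential. *)
    have inA t : inside c t -> al v t.
      by move=> ct; apply/asboolP; rewrite (gv v t hv ct).
    case: sh h cx inA => [[y -> ly]|->] h /= => [[lx xy]|lx] inA.
      have [? ?] := fci_closed (fal v) ly (fun t h1 h2 => inA t (conj h1 h2)).
      have [->|ne] := pselect (x = left_end c) => //.
      have [->|ne'] := pselect (x = y) => //.
      by apply: inA; split=> ?; [apply: ne|apply: ne']; ord.
    have [->|ne] := pselect (x = left_end c).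
      have [y ly] := no_max (left_end c).
      by case: (fci_closed (fal v) ly) => // t lt _; apply: inA.
    by apply: inA => ?; apply: ne; ord.
  move=> Ax; have nin : ~ inside c x.
    by move=> cx'; move: (gv v x hv cx'); rewrite g asboolT.
  have [->|ne] := pselect (x = left_end c); first by left; apply: left_endP.
  case: sh h cx nin => [[y -> ly]|->] h /= => [[lx xy]|lx] nin.
    have -> : x = y.
      apply: le_anti => //; apply: le_nn => yx; apply: nin; split=> // ?.
      by apply: ne; ord.
    by right; apply: right_endP h.
  by exfalso; apply: nin => ?; apply: ne; ord.
- move=> mu nf [x [c0 h0 c0x]].
  (* The unbounded gap carries the last transition, whose target is the final state of the run. A
     label with non-final target thus has bounded gaps only, and the greatest of their right ends is
     the maximum. *)
  have Icc_shape c : List.In (mu, c) ps -> exists2 y, c = Icc I (left_end c) y & left_end c ≺ y.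
    move=> h; have [_ [//|e] _ _] := psP _ _ h.
    by rewrite e in h; move: nf; rewrite (pieces_last h) fin.
  pose right_end (p : label * cint I) := match p.2 with Icc _ j | Ici j | Iic j => j end.
  have [|m [u hm] Hm] := @list_extremum le (fun w => exists u, List.In (mu, Icc I u w) ps)
    (map right_end ps) le_total le_trans.
    have [y e _] := Icc_shape _ h0; exists y; last by exists (left_end c0); rewrite -e.
    rewrite e in h0; exact: (List.in_map right_end _ _ h0).
  exists m; split.
    by have [y' [e] uy] := Icc_shape _ hm; subst y'; apply: XI hm _; split; ord.
  move=> y [c h cy]; have [w e _] := Icc_shape _ h; rewrite e in h cy.
  apply: (le_trans cy.2); apply: Hm; first exact: (List.in_map right_end _ _ h).
  by exists (left_end c).
Qed.

End Certificate.

(** * The existential formula for acceptance *)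

Definition f_incl (a b : term) : formula := FEq (TInter a b) a.
Definition f_disj (a b : term) : formula := FEq (TInter a b) TBot.
Definition f_all (fs : seq formula) : formula := foldr FAnd (FNot FFalse) fs.
Definition t_union (ts : seq term) : term := foldr TUnion TBot ts.
Definition f_exists (ns : seq nat) (f : formula) : formula := foldr FEx f ns.

Local Notation Sat := (sat I le z).
Local Notation Eval := (eval I le z).

Lemma sat_incl rho a b : Sat rho (f_incl a b) <-> forall x, Eval rho a x -> Eval rho b x.
Proof.
split=> [H x ax|H x /=]; first by have [_ /(_ ax)[]] := H x.
by split=> [[]//|ax]; split=> //; apply: H.
Qed.

Lemma sat_disj rho a b :
  Sat rho (f_disj a b) <-> forall x, Eval rho a x -> ~ Eval rho b x.
Proof.
split=> [H x ax bx|H x /=]; first by have [/(_ (conj ax bx))] := H x.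
by split=> // -[/H].
Qed.

Lemma sat_all (T : eqType) (F : T -> formula) (s : seq T) rho :
  Sat rho (f_all (map F s)) <-> {in s, forall i, Sat rho (F i)}.
Proof.
elim: s => [|i s IH] /=; first by split=> // _; apply.
split=> [[Fi /IH Fs] j|H].
  by rewrite inE => /predU1P[->|/Fs].
by split; [apply: H|apply/IH => j js; apply: H]; rewrite inE ?eqxx // js orbT.
Qed.

Lemma eval_union (T : eqType) (F : T -> term) (s : seq T) rho x :
  Eval rho (t_union (map F s)) x <-> exists2 i, i \in s & Eval rho (F i) x.
Proof.
elim: s => [|i s IH] /=; first by split=> [[]|[]].
split=> [[Fi|/IH[j js Fj]]|[j]].
- by exists i; rewrite ?inE ?eqxx.
- by exists j; rewrite ?inE ?js ?orbT.
- by rewrite inE => /predU1P[->|js] Fj; [left|right; apply/IH; exists j].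
Qed.

Lemma sat_exists (ns : seq nat) f rho : Sat rho (f_exists ns f) <->
  exists rho', [/\ forall n, n \notin ns -> rho' n = rho n,
    forall n, n \in ns -> fci (rho' n) & Sat rho' f].
Proof.
elim: ns rho => [|n ns IH] rho /=.
  split=> [h|[rho' [e _ h]]]; first by exists rho.
  by have <- : rho' = rho by apply: funext => n; apply: e.
have updE A m : update I rho n A m = if m == n then A else rho m by [].
split=> [[A [fA /IH[rho' [e fr h]]]]|[rho' [e fr h]]].
  exists rho'; split=> // m; rewrite inE.
    by rewrite negb_or => /andP[/negbTE mn /e ->]; rewrite updE mn.
  case: (boolP (m \in ns)) => [/fr//|/e ->]; rewrite orbF updE.
  by move=> ->.
exists (rho' n); split; first by apply: fr; rewrite inE eqxx.
apply/IH; exists rho'; split=> // m hm.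
  rewrite updE; case: eqVneq => [->//|mn]; apply: e.
  by rewrite inE negb_or mn.
by apply: fr; rewrite inE hm orbT.
Qed.

Lemma existential_exists (ns : seq nat) f : qf f -> existential (f_exists ns f).
Proof.
by move=> qf_f; elim: ns => [|n ns IH] /=; [apply: ex_qf|apply: ex_ex].
Qed.

Lemma qf_all (T : Type) (F : T -> formula) (s : seq T) :
  (forall i, qf (F i)) -> qf (f_all (map F s)).
Proof. by move=> H; elim: s => //= i s IH; split. Qed.

Section CertificateFormula.

Variables (V : eqType) (D : dfa V) (tm : V -> term) (base : nat).

Local Notation vs := (support D).

(** Indices from [base] on are reserved for the coded run; [base] is to exceed every variable that
    the terms [tm] read. *)
Definition cert_var (mu : label D) : nat := base + enum_rank mu.

Local Notation xv mu := (TVar (cert_var mu)).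

(** The choice of a label in [cert_init] and [cert_step] ranges over a finite type, so it becomes a
    union and each of these clauses becomes an inclusion of terms. *)
Definition lefts_from (q : state D) : term :=
  t_union [seq TL (xv mu) | mu <- enum (label D) & source mu == q].

Definition cert_local mu v : formula :=
  FAnd (if point_val mu v then f_incl (TL (xv mu)) (tm v)
        else f_disj (TL (xv mu)) (tm v))
       (if gap_val mu v then f_incl (xv mu) (tm v)
        else f_incl (TInter (xv mu) (tm v)) (TUnion (TL (xv mu)) (TR (xv mu)))).

Definition cert_label mu : formula :=
  FAnd (f_disj (TL (xv mu)) (TR (xv mu)))
  (FAnd (f_incl (TR (xv mu)) (lefts_from (target mu)))
  (FAnd (if final (target mu) then FNot FFalse
         else FOr (FEq (xv mu) TBot) (FNot (FEq (TMax (xv mu)) TBot)))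
        (f_all [seq cert_local mu v | v <- vs]))).

Definition cert_body : formula :=
  FAnd (f_incl TC0 (lefts_from (init D)))
       (f_all [seq cert_label mu | mu <- enum (label D)]).

Lemma qf_cert_body : qf cert_body.
Proof.
split=> //; apply: qf_all => mu; do 2!split=> //; split; first by case: ifP.
by apply: qf_all => v; split; case: ifP.
Qed.

Lemma eval_lefts_from rho q x : Eval rho (lefts_from q) x <->
  exists mu, source mu = q /\ s_l I le (rho (cert_var mu)) x.
Proof.
rewrite eval_union; split=> [[mu]|[mu [e lx]]].
  by rewrite mem_filter => /andP[/eqP e _]; exists mu.
by exists mu => //; rewrite mem_filter e eqxx mem_enum.
Qed.

Lemma sat_cert_body rho al :
  (forall v, v \in vs -> Eval rho (tm v) = al v) ->
  Sat rho cert_body <-> certificate (fun mu : label D => rho (cert_var mu)) al.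
Proof.
move=> tmE; split.
  case=> [/sat_incl H0 /sat_all H].
  have {}H mu := H mu (mem_enum _ mu).
  split.
  - by apply/eval_lefts_from; apply: H0.
  - by move=> mu x; case: (H mu) => /sat_disj h _; apply: h.
  - move=> mu x; case: (H mu) => _ [/sat_incl h _] rx.
    by apply/eval_lefts_from; apply: h.
  - move=> mu v x hv; case: (H mu) => _ [_ [_ /sat_all /(_ v hv) [h _]]].
    by move: h; case: ifP => _; [move/sat_incl|move/sat_disj] => h lx;
      rewrite -tmE //; apply: h.
  - move=> mu v x hv; case: (H mu) => _ [_ [_ /sat_all /(_ v hv) [_ h]]].
    move: h; case: ifP => _ /sat_incl h Xx; rewrite -tmE //; first exact: h.
    by move=> Ax; apply: h.
  - move=> mu nf [x Xx]; case: (H mu) => _ [_ []].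
    rewrite (negbTE nf) => -[h|h] _; first by case: (h x) => /(_ Xx).
    by apply: contrapT => ne; apply: h => y; split=> // my; apply: ne; exists y.
case=> h0 h1 h2 h3 h4 h5; split.
  by apply/sat_incl => x ->; apply/eval_lefts_from.
apply/sat_all => mu _; split; first by apply/sat_disj => x; apply: h1.
split; first by apply/sat_incl => x /h2 h; apply/eval_lefts_from.
split.
  case: ifPn => [_ //|nf].
  have [ex|nex] := pselect (exists x, rho (cert_var mu) x); last first.
    by left=> x; split=> // Xx; apply: nex; exists x.
  by right=> H; have [x mx] := h5 mu nf ex; case: (H x) => /(_ mx).
apply/sat_all => v hv; split.
  have := h3 mu v; case: ifP => _ h; [apply/sat_incl|apply/sat_disj] => x lx;
    by rewrite tmE //; apply: h.
have := h4 mu v; case: ifP => _ h; apply/sat_incl => x.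
  by move=> Xx; rewrite tmE //; apply: h.
by case=> Xx Ax; apply: h => //; rewrite -tmE.
Qed.

Definition cert_formula : formula :=
  f_exists (map cert_var (enum (label D))) cert_body.

Lemma sat_cert_formula rho al : (forall n, fci (rho n)) ->
  (forall v, fci (al v)) ->
  (forall rho', (forall n, n < base -> rho' n = rho n) ->
     forall v, v \in vs -> Eval rho' (tm v) = al v) ->
  forall s, compat vs al z s ->
  Sat rho cert_formula <-> final (run (init D) (word al z s)).
Proof.
move=> fr fal tmE s c.
have varP n : n < base -> n \notin map cert_var (enum (label D)).
  by move=> nb; apply/mapP => -[mu _ e]; move: nb; rewrite e /cert_var ltnNge leq_addr.
split=> [/sat_exists[rho' [e fr' h]]|fin].
  have cert : certificate (fun mu : label D => rho' (cert_var mu)) al.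
    by apply/sat_cert_body => // v hv; apply: tmE => // n /varP/e.
  have fX (mu : label D) : fci (rho' (cert_var mu)).
    by apply: fr'; apply: map_f; rewrite mem_enum.
  have mapIn (T : eqType) (F : T -> I -> Prop) (r : seq T) B :
      List.In B (map F r) -> exists2 i, i \in r & B = F i.
    elim: r => [//|i r IH] /= [<-|/IH[j jr ->]].
      by exists i; rewrite ?inE ?eqxx.
    by exists j; rewrite ?inE ?jr ?orbT.
  have Inmap (T : eqType) (F : T -> I -> Prop) (r : seq T) i :
      i \in r -> List.In (F i) (map F r).
    by elim: r => [//|j r IH] /=; rewrite inE => /predU1P[->|/IH]; [left|right].
  (* The cuts [s] suit only the sets read by the automaton; soundness needs cuts that also suit the
     witnesses, and [run_uniq] carries the verdict back. *)
  have [|s' i' gc] := @exists_gap_const (map al vs ++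
      map (fun mu : label D => rho' (cert_var mu)) (enum (label D))).
    by move=> B /(List.in_app_or _ _ _)[] /mapIn[j _ ->]; apply: fci_pc.
  have c' : compat vs al z s'.
    by split=> // v hv; apply: gc; apply/List.in_or_app; left; apply: Inmap.
  rewrite (run_uniq _ c c'); apply: (certificate_sound fX cert c') => mu.
  apply: gc; apply/List.in_or_app; right.
  by apply: (Inmap _ (fun mu => rho' (cert_var mu))); rewrite mem_enum.
have [X [fX cert]] := certificate_complete fal c fin.
pose rho' n := if [pick mu | cert_var mu == n] is Some mu then X mu else rho n.
have rhoE mu : rho' (cert_var mu) = X mu.
  rewrite /rho'; case: pickP => [nu /eqP/addnI/ord_inj/enum_rank_inj->//|].
  by move/(_ mu); rewrite eqxx.
have rhoN n : n \notin map cert_var (enum (label D)) -> rho' n = rho n.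
  move=> h; rewrite /rho'; case: pickP => // mu /eqP e.
  by case/mapP: h; exists mu; rewrite ?mem_enum.
apply/sat_exists; exists rho'; split=> // [n /mapP[mu _ ->]|].
  by rewrite rhoE.
apply/(sat_cert_body (al := al)) => [v hv|].
  by apply: tmE => // n /varP/rhoN.
by rewrite (_ : (fun mu => _) = X) //; apply: funext.
Qed.

End CertificateFormula.

Lemma model_complete : model_complete_LI I le z.
Proof.
move=> f; have [P [D H] PE] := def_sat f.
(* The automaton may still mention element variables although satisfaction does not depend on them.
   All are set to [z], whose singleton is named by the constant. *)
pose tm (v : nat + nat) := if v is inl n then TVar n else TC0.
pose base := (\max_(v <- support D) if v is inl n then n else 0).+1.
exists (cert_formula D tm base); split.
  by apply: existential_exists; apply: qf_cert_body.
move=> rho fr; pose al := encode rho (fun _ => z).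
have fal v : fci (al v).
  by case: v => [n|i]; [apply: fr|apply: (@fci_finite _ [:: z]) => x ->; left].
have pal v : pc (al v) by apply: fci_pc.
have [|s i gc] := @exists_gap_const (map al (support D)).
  move=> A; elim: (support D) => [//|v r IH] /= [<-|/IH//]; exact: pal.
have c : compat (support D) al z s.
  split=> // v hv; apply: gc.
  by elim: (support D) hv => [//|w r IH]; rewrite inE => /predU1P[->|/IH]; [left|right].
rewrite -(PE rho (fun _ => z) fr) (H al pal s c).
apply: iff_sym; apply: (sat_cert_formula fr fal _ c).
move=> rho' e [n|j] hv //=; apply: e.
by rewrite ltnS; apply: (leq_bigmax_seq (F := fun v : nat + nat => if v is inl n then n else 0)) hv _.
Qed.

End Model.

Theorem theorem7p1 (I : Type) (le : I -> I -> Prop) (z : I)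
  (HI : dlo_left_endpoint_no_right I le z) :
  model_complete_LI I le z.
Proof. exact: model_complete. Qed.
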